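(* Let $\mathcal{H}=\mathcal{H}_A\otimes\mathcal{H}_B$ be a finite-dimensional bipartite Hilbert space and let $\rho$ be a state on $\mathcal{H}$. Then $$\mathcal{E}_{\max}(\rho)=E_R^\infty(\rho),$$ where $\mathcal{E}_{\max}(\rho):=\lim_{\varepsilon\to 0}\limsup_{n\to\infty}\frac{1}{n}E^{\varepsilon}_{\max}(\rho^{\otimes n})$ and $E_R^\infty(\rho):=\lim_{n\to\infty}\frac1n E_R(\rho^{\otimes n})$.
   Context: Logarithms are base 2. For $n\ge1$, $\mathcal{S}_n$ denotes the set of separable states on $\mathcal{H}^{\otimes n}=\mathcal{H}_A^{\otimes n}\otimes\mathcal{H}_B^{\otimes n}$ (separable with respect to the cut $A^n|B^n$). For a positive operator $\bar\rho$ (possibly subnormalized) and a positive operator $\sigma$ with $\mathrm{supp}\,\bar\rho\subseteq\mathrm{supp}\,\sigma$, the max-relative entropy is $D_{\max}(\bar\rho\|\sigma):=\log\min\{\lambda:\bar\rho\le\lambda\sigma\}$. For $\varepsilon\ge0$ and a state $\omega$, $B^\varepsilon(\omega):=\{\bar\omega\ge0:\|\bar\omega-\omega\|_1\le\varepsilon,\ \mathrm{Tr}\,\bar\omega\le\mathrm{Tr}\,\omega\}$, and $D^\varepsilon_{\max}(\omega\|\sigma):=\min_{\bar\omega\in B^\varepsilon(\omega)}D_{\max}(\bar\omega\|\sigma)$. The smooth max-relative entropy of entanglement of a state $\omega$ on $\mathcal{H}^{\otimes n}$ is $E^\varepsilon_{\max}(\omega):=\min_{\sigma\in\mathcal{S}_n}D^\varepsilon_{\max}(\omega\|\sigma)$.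 The relative entropy of entanglement is $E_R(\omega):=\min_{\sigma\in\mathcal{S}_n}S(\omega\|\sigma)$, with $S(\omega\|\sigma)=\mathrm{Tr}\,\omega(\log\omega-\log\sigma)$ the quantum relative entropy. *)

(* Defs.v *)
From HB Require Import structures.
From mathcomp Require Import all_boot all_order all_algebra.
From mathcomp Require Import complex mxtens.
From mathcomp Require Import all_classical all_reals all_analysis.

Set Implicit Arguments.
Unset Strict Implicit.
Unset Printing Implicit Defensive.

Import Order.TTheory GRing.Theory Num.Theory.
Local Open Scope ring_scope.
Local Open Scope complex_scope.
Local Open Scope classical_set_scope.

Section QuantumDefs.
Variable R : realType.
Local Notation C := R[i].

Definition log2 (x : R) : R := ln x / ln 2.

Definition psdmx n (M : 'M[C]_n) : Prop :=
  forall v : 'cV[C]_n, 0 <= ((map_mx Num.conj v)^T *m M *m v) 0 0.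

Definition mxle n (A B : 'M[C]_n) : Prop := psdmx (B - A).

Definition is_state n (rho : 'M[C]_n) : Prop := psdmx rho /\ \tr rho = 1.

(* trace norm, for normal (in particular Hermitian) matrices:
   sum of the absolute values of the eigenvalues *)
Definition trnorm n (X : 'M[C]_n) : C := \sum_i `|spectral_diag X 0 i|.

(* max-relative entropy  D_max(rb || s) = log min {l : rb <= l s}
   (= -oo when rb = 0, = +oo when supp rb is not contained in supp s) *)
Definition Dmax n (rb s : 'M[C]_n) : \bar R :=
  ereal_inf [set (log2 l)%:E | l in [set l : R | 0 < l /\ mxle rb (l%:C *: s)]].

Definition Bball n (eps : R) (w : 'M[C]_n) : set 'M[C]_n :=
  [set wb | psdmx wb /\ trnorm (wb - w) <= eps%:C /\ \tr wb <= \tr w].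

Definition Dmax_eps n (eps : R) (w s : 'M[C]_n) : \bar R :=
  ereal_inf [set Dmax wb s | wb in Bball eps w].

(* separable states on C^a (x) C^b (Kronecker product tensmx, index (i,j) |-> i*b+j) *)
Definition separable (a b : nat) (s : 'M[C]_(a * b)) : Prop :=
  exists (k : nat) (p : 'I_k -> R) (al : 'I_k -> 'M[C]_a) (be : 'I_k -> 'M[C]_b),
    [/\ (forall j, 0 <= p j), \sum_j p j = 1,
        (forall j, is_state (al j) /\ is_state (be j)) &
        s = \sum_j (p j)%:C *: tensmx (al j) (be j)].

Definition Emax_eps (a b : nat) (eps : R) (w : 'M[C]_(a * b)) : \bar R :=
  ereal_inf [set Dmax_eps eps w s | s in @separable a b].

(* matrix logarithm (base 2) on the support of a normal matrix, via the
   spectral decomposition A = P^-1 diag(d) P *)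
Definition mxlog2 n (A : 'M[C]_n) : 'M[C]_n :=
  let P := spectralmx A in
  let d := spectral_diag A in
  invmx P *m diag_mx (\row_i (if 0 < complex.Re (d 0 i) then (log2 (complex.Re (d 0 i)))%:C
                              else 0)) *m P.

(* quantum relative entropy S(w || s) = Tr w (log w - log s),
   +oo if supp w is not contained in supp s *)
Definition relent n (w s : 'M[C]_n) : \bar R :=
  if (kermx s <= kermx w)%MS then (complex.Re (\tr (w *m (mxlog2 w - mxlog2 s))))%:E
  else +oo%E.

Definition ER (a b : nat) (w : 'M[C]_(a * b)) : \bar R :=
  ereal_inf [set relent w s | s in @separable a b].

Definition digit (d : nat) (x k : nat) : 'I_d.+1 := inord ((x %/ d.+1 ^ k) %% d.+1)%N.

(* n-fold tensor power of a state rho on H_A (x) H_B, written as an operator on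
   H_A^{(x)n} (x) H_B^{(x)n}  (so that the cut A^n | B^n is the Kronecker cut) *)
Definition tpow (dA dB : nat) (rho : 'M[C]_(dA.+1 * dB.+1)) (n : nat)
  : 'M[C]_(dA.+1 ^ n * dB.+1 ^ n) :=
  \matrix_(i, j)
    \prod_(k < n)
      rho (mxtens_index (digit dA (mxtens_unindex i).1 k, digit dB (mxtens_unindex i).2 k))
          (mxtens_index (digit dA (mxtens_unindex j).1 k, digit dB (mxtens_unindex j).2 k)).

End QuantumDefs.

(* Main.v *)
(** Write f(n) = E_R(rho^n), g(n) = E_max^eps(rho^n) and L = inf_m f(m)/m, the
    infimum over m >= 1. The equality of the two limits follows from two estimates;
    neither subadditivity of f nor a generalized Stein lemma is needed.

    Upper bound: limsup g(n)/n <= f(m)/m for every m >= 1 and eps > 0. Given a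
    separable s on m copies, let w = rho^n and let t be the product of
    copies of s with a bounded number of maximally mixed factors. By Chebyshev's
    inequality, w has almost all its weight on the spectral subspace of t where
    log t is at least Tr w log t - o(n) (projector Pi), and on that of w where log w
    is at most Tr w log w + o(n) (projector Q). The operator Pi Q w Q Pi is then close
    to w and bounded by 2^(S(w||t) + o(n)) t.

    Lower bound: f(n) <= g(n) + 2 eps n log d + O(1), with d = dim H. If w' is
    eps-close to w = rho^n and w' <= l s, mix w and s with the maximally mixed
    state to get Z and s', so that log Z and log s' have norm O(n). Then
    Tr w log w <= Tr w log Z + 1, where w may be replaced by w'; Klein's inequality
    gives Tr w' log Z <= Tr w' log w' + O(1); w' <= 2 l s' gives
    Tr w' log w' <= Tr w' log s' + log (2 l); and w' may be replaced by w again.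

    Hence L <= f(n)/n and limsup f(n)/n <= limsup g(n)/n + O(eps) <= L + O(eps). *)

Require Import Defs.
From HB Require Import structures.
From mathcomp Require Import all_boot all_order all_algebra.
From mathcomp Require Import complex mxtens.
From mathcomp Require Import all_classical all_reals all_analysis.
From mathcomp Require Import ring lra.
Set Implicit Arguments.
Unset Strict Implicit.
Unset Printing Implicit Defensive.
Import Order.TTheory GRing.Theory Num.Theory.
Local Open Scope ring_scope.
Local Open Scope complex_scope.
Local Open Scope classical_set_scope.
Import numFieldNormedType.Exports.

(** * Hermitian operators and their functional calculus *)

Section Operators.
Variable R : realType.
Local Notation C := R[i].

Definition abs2 (z : C) : R := complex.Re z ^+ 2 + complex.Im z ^+ 2.

Lemma abs2E (z : C) : (abs2 z)%:C = z * Num.conj z.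
Proof.
case: z => a b; rewrite /abs2 /=; apply/eqP; rewrite eq_complex /=; apply/andP.
by split; apply/eqP; ring.
Qed.

Lemma abs2_ge0 z : 0 <= abs2 z.
Proof. by rewrite addr_ge0 ?sqr_ge0. Qed.

Lemma abs2M z w : abs2 (z * w) = abs2 z * abs2 w.
Proof. by case: z w => [a b] [c d]; rewrite /abs2 /=; ring. Qed.

Lemma abs2_real (x : R) : abs2 x%:C = x ^+ 2.
Proof. by rewrite /abs2 /= expr0n addr0. Qed.

Lemma conj_real_complex (x : R) : Num.conj (x%:C : C) = x%:C.
Proof. exact: conjc_real. Qed.

Lemma Re_sum (I : Type) (r : seq I) (P : pred I) (F : I -> C) :
  complex.Re (\sum_(i <- r | P i) F i) = \sum_(i <- r | P i) complex.Re (F i).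
Proof. by apply: (big_morph (@complex.Re R)) => // -[? ?] []. Qed.

Lemma Re_D (x y : C) : complex.Re (x + y) = complex.Re x + complex.Re y.
Proof. by case: x y => ? ? []. Qed.

Lemma Re_B (x y : C) : complex.Re (x - y) = complex.Re x - complex.Re y.
Proof. by case: x y => ? ? []. Qed.

Lemma sum_real_complex (I : Type) (r : seq I) (P : pred I) (F : I -> R) :
  (\sum_(i <- r | P i) F i)%:C = \sum_(i <- r | P i) (F i)%:C :> C.
Proof. exact: (rmorph_sum (real_complex R)). Qed.

Definition adjm m n (A : 'M[C]_(m, n)) : 'M[C]_(n, m) := (map_mx Num.conj A)^T.

Lemma adjmM m n p (A : 'M[C]_(m, n)) (B : 'M[C]_(n, p)) :
  adjm (A *m B) = adjm B *m adjm A.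
Proof. by rewrite /adjm map_mxM trmx_mul. Qed.

Lemma adjmK m n (A : 'M[C]_(m, n)) : adjm (adjm A) = A.
Proof. by apply/matrixP => i j; rewrite !mxE conjCK. Qed.

Lemma adjmD m n (A B : 'M[C]_(m, n)) : adjm (A + B) = adjm A + adjm B.
Proof. by rewrite /adjm map_mxD linearD. Qed.

Lemma adjmN m n (A : 'M[C]_(m, n)) : adjm (- A) = - adjm A.
Proof. by rewrite /adjm map_mxN linearN. Qed.

Lemma adjmB m n (A B : 'M[C]_(m, n)) : adjm (A - B) = adjm A - adjm B.
Proof. by rewrite adjmD adjmN. Qed.

Lemma adjm1 n : adjm (1%:M : 'M[C]_n) = 1%:M.
Proof. by rewrite /adjm map_mx1 trmx1. Qed.

Lemma unitary_mulV n (P : 'M[C]_n) : P \is unitarymx -> P *m adjm P = 1%:M.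
Proof. by move=> /unitarymxP; rewrite /adjm map_trmx. Qed.

Lemma unitary_Vmul n (P : 'M[C]_n) : P \is unitarymx -> adjm P *m P = 1%:M.
Proof. by move=> /unitary_mulV /mulmx1C. Qed.

Lemma mulV_unitary n (P : 'M[C]_n) : P *m adjm P = 1%:M -> P \is unitarymx.
Proof. by move=> h; apply/unitarymxP; rewrite -h /adjm map_trmx. Qed.

Lemma invmx_adjm n (P : 'M[C]_n) : P \is unitarymx -> invmx P = adjm P.
Proof. by move=> Pu; rewrite invmx_unitary // /adjm map_trmx. Qed.

(* The operator with real eigenvalues [f] and eigenvectors the conjugated rows of
   the unitary [P]; [opf P (g \o f)] is the functional calculus of [opf P f]. *)
Definition opf n (P : 'M[C]_n) (f : 'I_n -> R) : 'M[C]_n :=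
  adjm P *m diag_mx (\row_i (f i)%:C) *m P.

Lemma eq_opf n (P : 'M[C]_n) f g : f =1 g -> opf P f = opf P g.
Proof.
move=> fg; rewrite /opf; congr (_ *m diag_mx _ *m _).
by apply/rowP => i; rewrite !mxE fg.
Qed.

Lemma opfM n (P : 'M[C]_n) f g : P \is unitarymx ->
  opf P f *m opf P g = opf P (fun i => f i * g i).
Proof.
move=> Pu; rewrite /opf -!mulmxA; congr (_ *m _).
rewrite (mulmxA P) unitary_mulV // mul1mx !mulmxA; congr (_ *m _).
rewrite mulmx_diag; congr diag_mx; apply/rowP => i.
by rewrite !mxE rmorphM.
Qed.

Lemma opfD n (P : 'M[C]_n) f g : opf P f + opf P g = opf P (fun i => f i + g i).
Proof.
rewrite /opf -mulmxDl -mulmxDr; congr (_ *m _ *m _).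
by apply/matrixP => i j; rewrite !mxE -mulrnDl rmorphD.
Qed.

Lemma opfZ n (P : 'M[C]_n) c f : c%:C *: opf P f = opf P (fun i => c * f i).
Proof.
rewrite /opf scalemxAl scalemxAr; congr (_ *m _ *m _).
by apply/matrixP => i j; rewrite !mxE rmorphM /= mulrnAr.
Qed.

Lemma opfB n (P : 'M[C]_n) f g : opf P f - opf P g = opf P (fun i => f i - g i).
Proof.
rewrite -scaleN1r -[-1]/((-1 : R[i])) -(rmorphN1 (real_complex R)) opfZ opfD.
by apply: eq_opf => i; rewrite mulN1r.
Qed.

Lemma opf_cst n (P : 'M[C]_n) (c : R) : P \is unitarymx ->
  opf P (fun=> c) = (c%:C)%:M.
Proof.
move=> Pu; rewrite /opf.
have -> : diag_mx (\row_(i < n) c%:C) = (c%:C)%:M.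
  by apply/matrixP => i j; rewrite !mxE.
by rewrite scalar_mxC -mulmxA unitary_Vmul // mulmx1.
Qed.

Lemma opf1 n (P : 'M[C]_n) : P \is unitarymx -> opf P (fun=> 1) = 1%:M.
Proof. by move=> Pu; rewrite opf_cst. Qed.

Lemma adj_opf n (P : 'M[C]_n) f : adjm (opf P f) = opf P f.
Proof.
rewrite /opf !adjmM adjmK mulmxA; congr (_ *m _ *m _).
apply/matrixP => i j; rewrite !mxE eq_sym; case: eqVneq => [->|_].
  by rewrite !mulr1n conj_real_complex.
by rewrite !mulr0n rmorph0.
Qed.

Lemma mulmx_diag_tr n (d e : 'rV[C]_n) (W V : 'M[C]_n) :
  \tr (diag_mx d *m W *m diag_mx e *m V) =
  \sum_i \sum_j d 0 i * W i j * e 0 j * V j i.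
Proof.
rewrite /mxtrace; apply: eq_bigr => i _; rewrite mxE; apply: eq_bigr => j _.
congr (_ * _); rewrite mul_mx_diag mxE; congr (_ * _).
by rewrite mul_diag_mx mxE.
Qed.

(** Squared modulus of the inner product of the [i]-th vector of the basis [P] with the [j]-th of
    [U]. For unitary [P] and [U] it is doubly stochastic, and traces of products of noncommuting
    operators become classical double sums weighted by it. *)
Definition ov n (P U : 'M[C]_n) (i j : 'I_n) : R := abs2 ((P *m adjm U) i j).

Lemma ov_ge0 n (P U : 'M[C]_n) i j : 0 <= ov P U i j.
Proof. exact: abs2_ge0. Qed.

Lemma tr_opf2 n (P U : 'M[C]_n) f g :
  \tr (opf P f *m opf U g) = (\sum_i \sum_j f i * ov P U i j * g j)%:C.
Proof.
rewrite /opf -!mulmxA mxtrace_mulC !mulmxA -(mulmxA (diag_mx _) P).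
rewrite -(mulmxA _ U) mulmx_diag_tr sum_real_complex; apply: eq_bigr => i _.
rewrite sum_real_complex; apply: eq_bigr => j _.
have -> : U *m adjm P = adjm (P *m adjm U) by rewrite adjmM adjmK.
rewrite !rmorphM /= /ov abs2E !mxE.
by rewrite mulrAC !mulrA.
Qed.

Lemma ov_row n (P U : 'M[C]_n) i : P \is unitarymx -> U \is unitarymx ->
  \sum_j ov P U i j = 1.
Proof.
move=> Pu Uu; apply: (@complexI R); rewrite sum_real_complex.
have: ((P *m adjm U) *m adjm (P *m adjm U)) i i = 1.
  by rewrite adjmM adjmK -mulmxA (mulmxA _ U) unitary_Vmul // mul1mx
     unitary_mulV // mxE eqxx.
rewrite mxE => h; rewrite [RHS]rmorph1 -h; apply: eq_bigr => j _.
by rewrite /ov abs2E !mxE.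
Qed.

Lemma ovC n (P U : 'M[C]_n) i j : ov P U i j = ov U P j i.
Proof.
apply: (@complexI R); rewrite /ov !abs2E.
have -> : U *m adjm P = adjm (P *m adjm U) by rewrite adjmM adjmK.
by rewrite [in RHS]mxE [in RHS]mxE conjCK mulrC.
Qed.

Lemma ov_col n (P U : 'M[C]_n) j : P \is unitarymx -> U \is unitarymx ->
  \sum_i ov P U i j = 1.
Proof. by move=> Pu Uu; under eq_bigr do rewrite ovC; rewrite ov_row. Qed.

Lemma tr_opf n (P : 'M[C]_n) f : P \is unitarymx -> \tr (opf P f) = (\sum_i f i)%:C.
Proof.
move=> Pu; rewrite /opf -mulmxA mxtrace_mulC -mulmxA unitary_mulV // mulmx1.
by rewrite mxtrace_diag sum_real_complex; apply: eq_bigr => i _; rewrite mxE.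
Qed.

Lemma sum_ov n (P U : 'M[C]_n) f : P \is unitarymx -> U \is unitarymx ->
  \sum_j \sum_i f i * ov P U i j = \sum_i f i.
Proof.
move=> Pu Uu; rewrite exchange_big; apply: eq_bigr => i _.
by rewrite -mulr_sumr ov_row // mulr1.
Qed.

(** * Quadratic forms and positive semidefinite matrices *)

Definition qf n (M : 'M[C]_n) (v : 'cV[C]_n) : C := (adjm v *m M *m v) 0 0.

Lemma qf_opf n (P : 'M[C]_n) f v :
  qf (opf P f) v = (\sum_i f i * abs2 ((P *m v) i 0))%:C.
Proof.
rewrite /qf /opf.
have -> : adjm v *m (adjm P *m diag_mx (\row_i (f i)%:C) *m P) *m v =
  adjm (P *m v) *m (diag_mx (\row_i (f i)%:C) *m (P *m v)).
  by rewrite adjmM !mulmxA.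
rewrite mxE sum_real_complex; apply: eq_bigr => i _.
rewrite rmorphM /= abs2E mul_diag_mx !mxE; ring.
Qed.

Lemma psd_opf n (P : 'M[C]_n) f : (forall i, 0 <= f i) -> psdmx (opf P f).
Proof.
move=> f0 v; rewrite -/(qf _ v) qf_opf ler0c sumr_ge0 // => i _.
by rewrite mulr_ge0 // abs2_ge0.
Qed.

Lemma opf_psd n (P : 'M[C]_n) f : P \is unitarymx -> psdmx (opf P f) ->
  forall i, 0 <= f i.
Proof.
move=> Pu h i; have := h (adjm P *m delta_mx i 0).
rewrite -/(qf _ _) qf_opf ler0c mulmxA unitary_mulV // mul1mx (bigD1 i) //=.
rewrite mxE !eqxx big1 => [|j ji]; last by rewrite mxE (negbTE ji) abs2_real expr0n mulr0.
by rewrite addr0 -[(true && true)%:R]/((1 : R)%:C) abs2_real expr1n mulr1.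
Qed.

Lemma psd_qf n (M : 'M[C]_n) v : psdmx M -> 0 <= qf M v.
Proof. by move=> h; exact: h. Qed.

Lemma qfB n (A B : 'M[C]_n) v : qf (A - B) v = qf A v - qf B v.
Proof. by rewrite /qf mulmxBr mulmxBl [LHS]mxE [X in _ + X]mxE. Qed.

Lemma psd_conj m n (A : 'M[C]_(m, n)) (M : 'M[C]_n) :
  psdmx M -> psdmx (A *m M *m adjm A).
Proof.
move=> h v; have := h (adjm A *m v).
by rewrite -!/(adjm _) adjmM adjmK !mulmxA.
Qed.

Lemma psd_add n (M N : 'M[C]_n) : psdmx M -> psdmx N -> psdmx (M + N).
Proof.
move=> hM hN v; rewrite mulmxDr mulmxDl mxE.
by rewrite addr_ge0.
Qed.

Lemma psd_scale n (c : R) (M : 'M[C]_n) : 0 <= c -> psdmx M -> psdmx (c%:C *: M).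
Proof.
move=> c0 hM v; rewrite -scalemxAr -scalemxAl mxE mulr_ge0 ?ler0c //; exact: hM.
Qed.

Lemma psd_sum n (I : Type) (r : seq I) (F : I -> 'M[C]_n) :
  (forall i, psdmx (F i)) -> psdmx (\sum_(i <- r) F i).
Proof.
move=> hF; elim: r => [|i r IH]; last by rewrite big_cons; apply: psd_add (hF i) IH.
by rewrite big_nil => v; rewrite mulmx0 mul0mx mxE.
Qed.

(** A nonnegative complex number is real, so the antihermitian, hence normal, matrix [M - adjm M]
    has vanishing quadratic form; evaluated at its eigenvectors, this kills all its eigenvalues. *)
Lemma psd_herm n (M : 'M[C]_n) : psdmx M -> adjm M = M.
Proof.
move=> hM; pose H := M - adjm M.
have qH v : qf H v = 0.
  rewrite qfB /qf.
  have -> : adjm v *m adjm M *m v = adjm (adjm v *m M *m v).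
    by rewrite !adjmM adjmK mulmxA.
  have := hM v; rewrite -/(adjm v); set x := (_ *m v) 0 0 => x0.
  have -> : adjm (adjm v *m M *m v) 0 0 = Num.conj x by rewrite mxE mxE.
  by rewrite (CrealP (ger0_real x0)) subrr.
have aH : adjm H = - H by rewrite /H adjmB adjmK opprB.
have nH : H \is normalmx.
  by apply/normalmxP; rewrite -map_trmx -/(adjm H) aH mulmxN mulNmx.
have Hd := orthomx_spectralP nH.
set P := spectralmx H in Hd; set d := spectral_diag H in Hd.
have Pu : P \is unitarymx := spectral_unitarymx H.
rewrite (invmx_adjm Pu) in Hd.
suff: H = 0 by move/eqP; rewrite subr_eq0 => /eqP.
rewrite Hd; suff -> : d = 0 by rewrite linear0 mulmx0 mul0mx.
apply/rowP => i; rewrite mxE.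
have := qH (adjm P *m delta_mx i 0).
rewrite /qf Hd adjmM adjmK !mulmxA -(mulmxA _ P) unitary_mulV // mulmx1.
rewrite -(mulmxA _ P) unitary_mulV // mulmx1.
rewrite -mulmxA mxE (bigD1 i) //= big1 => [|j ji]; last first.
  by rewrite !mxE (negbTE ji) rmorph0 mul0r.
rewrite mul_diag_mx !mxE !eqxx addr0 rmorph1 mul1r mulr1; exact.
Qed.

(** * Spectra of Hermitian matrices, logarithm and trace norm *)

Definition eig n (M : 'M[C]_n) (i : 'I_n) : R := complex.Re (spectral_diag M 0 i).

Lemma spectral_diag_real n (M : 'M[C]_n) i : adjm M = M ->
  spectral_diag M 0 i = (eig M i)%:C.
Proof.
move=> hM; have hs : M \is hermsymmx.
  by apply/is_hermitianmxP; rewrite expr0 scale1r -map_trmx -/(adjm M) hM.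
by rewrite RRe_real //; exact: (mxOverP (hermitian_spectral_diag_real hs)).
Qed.

Lemma herm_spectral n (M : 'M[C]_n) : adjm M = M ->
  M = opf (spectralmx M) (eig M).
Proof.
move=> hM; have nM : M \is normalmx.
  by apply/normalmxP; rewrite -map_trmx -/(adjm M) hM.
rewrite [LHS](orthomx_spectralP nM) (invmx_adjm (spectral_unitarymx M)) /opf.
congr (_ *m diag_mx _ *m _).
by apply/rowP => i; rewrite mxE -(spectral_diag_real i hM).
Qed.

(** The case distinction on the sign disappears because [ln], hence [log2], takes the value 0 at
    nonpositive arguments. *)
Lemma mxlog2E n (M : 'M[C]_n) :
  mxlog2 M = opf (spectralmx M) (fun i => log2 (eig M i)).
Proof.
rewrite /mxlog2 /opf (invmx_adjm (spectral_unitarymx M)).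
congr (_ *m diag_mx _ *m _); apply/rowP => i; rewrite !mxE.
by case: ltP => // h; rewrite /log2 ln0 // mul0r.
Qed.

Lemma trnorm_herm n (M : 'M[C]_n) : adjm M = M ->
  trnorm M = (\sum_i `|eig M i|)%:C.
Proof.
move=> hM; rewrite /trnorm sum_real_complex; apply: eq_bigr => i _.
rewrite (spectral_diag_real i hM) normc_def /= expr0n addr0.
by rewrite sqrtr_sqr.
Qed.

End Operators.

(** * Tensor products along a bijection *)

Section Tens2.
Variable R : realType.
Local Notation C := R[i].

(* Kronecker product along an arbitrary identification [i |-> (f i, g i)] of the
   index set with a product; it covers both [tensmx] and the regrouping of
   [(A^n B^n)(A^m B^m)] into [A^(n+m) B^(n+m)]. *)
Definition tens2 N p q (f : 'I_N -> 'I_p) (g : 'I_N -> 'I_q)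
  (X : 'M[C]_p) (Y : 'M[C]_q) : 'M[C]_N :=
  \matrix_(i, j) (X (f i) (f j) * Y (g i) (g j)).

Definition bij2 N p q (f : 'I_N -> 'I_p) (g : 'I_N -> 'I_q) :=
  bijective (fun i => (f i, g i)).

Section Fixed.
Variables (N p q : nat) (f : 'I_N -> 'I_p) (g : 'I_N -> 'I_q).
Hypothesis fg : bij2 f g.

Lemma sum_tens2 (S : nmodType) (F : 'I_p -> 'I_q -> S) :
  \sum_i F (f i) (g i) = \sum_a \sum_b F a b.
Proof.
rewrite (pair_big xpredT xpredT) /= [RHS](reindex (fun i => (f i, g i))) //=.
exact: onW_bij.
Qed.

Lemma sum_tens2M (S : comNzRingType) (F : 'I_p -> S) (G : 'I_q -> S) :
  \sum_i F (f i) * G (g i) = (\sum_a F a) * (\sum_b G b).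
Proof.
rewrite (sum_tens2 (fun a b => F a * G b)) mulr_suml; apply: eq_bigr => a _.
by rewrite mulr_sumr.
Qed.

Lemma tens2M X Y X' Y' :
  tens2 f g X Y *m tens2 f g X' Y' = tens2 f g (X *m X') (Y *m Y').
Proof.
apply/matrixP => i j; rewrite !mxE.
rewrite -(sum_tens2M (fun a => X (f i) a * X' a (f j))
                     (fun b => Y (g i) b * Y' b (g j))).
by apply: eq_bigr => k _; rewrite !mxE mulrACA.
Qed.

Lemma adj_tens2 X Y : adjm (tens2 f g X Y) = tens2 f g (adjm X) (adjm Y).
Proof. by apply/matrixP => i j; rewrite !mxE rmorphM. Qed.

Lemma eq_fg i j : (i == j) = (f i == f j) && (g i == g j).
Proof. by rewrite -(inj_eq (bij_inj fg)). Qed.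

Lemma tens2_1 : tens2 f g 1%:M 1%:M = 1%:M.
Proof.
apply/matrixP => i j; rewrite !mxE eq_fg.
by case: (f i == f j); case: (g i == g j); rewrite ?mulr1 ?mulr0.
Qed.

Lemma tens2_unitary P U : P \is unitarymx -> U \is unitarymx ->
  tens2 f g P U \is unitarymx.
Proof.
move=> Pu Uu; apply: mulV_unitary.
by rewrite adj_tens2 tens2M (unitary_mulV Pu) (unitary_mulV Uu) tens2_1.
Qed.

Lemma tens2_opf P U r s : tens2 f g (opf P r) (opf U s) =
  opf (tens2 f g P U) (fun i => r (f i) * s (g i)).
Proof.
rewrite /opf -!tens2M adj_tens2; congr (_ *m _ *m _).
apply/matrixP => i j; rewrite !mxE eq_fg rmorphM /=.
by case: (f i == f j); case: (g i == g j); rewrite /= ?mulr1n ?mulr0n ?mulr0 ?mul0r.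
Qed.

Lemma ov_tens2 P U P' U' i j :
  ov (tens2 f g P U) (tens2 f g P' U') i j =
  ov P P' (f i) (f j) * ov U U' (g i) (g j).
Proof. by rewrite /ov adj_tens2 tens2M mxE abs2M. Qed.

Lemma tr_tens2 X Y : \tr (tens2 f g X Y) = \tr X * \tr Y.
Proof.
rewrite /mxtrace -(sum_tens2M (fun a => X a a) (fun b => Y b b)).
by apply: eq_bigr => i _; rewrite mxE.
Qed.

Lemma psd_tens2 X Y : psdmx X -> psdmx Y -> psdmx (tens2 f g X Y).
Proof.
move=> hX hY; have eX := herm_spectral (psd_herm hX).
have eY := herm_spectral (psd_herm hY).
have := opf_psd (spectral_unitarymx X); rewrite eX in hX => /(_ _ hX) r0.
have := opf_psd (spectral_unitarymx Y); rewrite eY in hY => /(_ _ hY) s0.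
by rewrite eX eY tens2_opf; apply: psd_opf => i; rewrite mulr_ge0.
Qed.

Lemma state_tens2 X Y : is_state X -> is_state Y -> is_state (tens2 f g X Y).
Proof.
move=> [hX tX] [hY tY]; split; first exact: psd_tens2.
by rewrite tr_tens2 tX tY mulr1.
Qed.

End Fixed.

Definition unf p q (i : 'I_(p * q)) := (mxtens_unindex i).1.
Definition ung p q (i : 'I_(p * q)) := (mxtens_unindex i).2.

Lemma unfg_bij p q : bij2 (@unf p q) (@ung p q).
Proof.
exists (@mxtens_index p q) => [i|[a b]].
  by rewrite /unf /ung -surjective_pairing mxtens_unindexK.
by rewrite /unf /ung mxtens_indexK.
Qed.

Lemma unfK p q (u : 'I_p * 'I_q) : unf (mxtens_index u) = u.1.
Proof. by rewrite /unf mxtens_indexK. Qed.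

Lemma ungK p q (u : 'I_p * 'I_q) : ung (mxtens_index u) = u.2.
Proof. by rewrite /ung mxtens_indexK. Qed.

Lemma unfgK p q (i : 'I_(p * q)) : mxtens_index (unf i, ung i) = i.
Proof. by rewrite /unf /ung -surjective_pairing mxtens_unindexK. Qed.

Lemma tensmx_tens2 p q (X : 'M[C]_p) (Y : 'M[C]_q) :
  tensmx X Y = tens2 (@unf p q) (@ung p q) X Y.
Proof. by []. Qed.

Lemma separable_state a b (s : 'M[C]_(a * b)) : separable s -> is_state s.
Proof.
case=> k [p] [al] [be] [p0 p1 st ->]; split.
  apply: psd_sum => j; apply: psd_scale => //; rewrite tensmx_tens2.
  have [[? _] [? _]] := st j; apply: psd_tens2 => //; exact: unfg_bij.
rewrite raddf_sum -[RHS]/((1 : R)%:C) -p1 [RHS]sum_real_complex.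
apply: eq_bigr => j _; rewrite [LHS](mxtraceZ (p j)%:C) tensmx_tens2.
rewrite (tr_tens2 (unfg_bij a b)).
by have [[_ ->] [_ ->]] := st j; rewrite !mulr1.
Qed.

Lemma separable_half a b (s t : 'M[C]_(a * b)) : separable s -> separable t ->
  separable ((2^-1)%:C *: (s + t)).
Proof.
case=> k [p] [al] [be] [p0 p1 st ->] [k' [p' [al' [be' [p0' p1' st' ->]]]]].
pose sel T (u : 'I_k -> T) (v : 'I_k' -> T) (i : 'I_(k + k')) :=
  match fintype.split i with inl j => u j | inr j => v j end.
have selP T (Q : T -> Prop) u v : (forall j, Q (u j)) -> (forall j, Q (v j)) ->
  forall i, Q (sel T u v i).
  by move=> hu hv i; rewrite /sel; case: (fintype.split i).
have sell T u v j : sel T u v (lshift k' j) = u j.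
  by rewrite /sel (unsplitK (inl j : 'I_k + 'I_k')).
have selr T u v j : sel T u v (rshift k j) = v j.
  by rewrite /sel (unsplitK (inr j : 'I_k + 'I_k')).
exists (k + k')%N, (fun i => 2^-1 * sel _ p p' i), (sel _ al al'), (sel _ be be').
split.
- by move=> j; rewrite mulr_ge0 ?invr_ge0 //; exact: (selP _ (fun x => 0 <= x)).
- rewrite -mulr_sumr big_split_ord /=.
  under eq_bigr do rewrite sell; under [X in _ + X]eq_bigr do rewrite selr.
  by rewrite p1 p1' -[1 + 1]/(2%:R) mulVf.
- by move=> j; rewrite /sel; case: (fintype.split j).
- rewrite big_split_ord /= scalerDr !scaler_sumr; congr (_ + _);
    by apply: eq_bigr => j _; rewrite ?sell ?selr scalerA rmorphM.
Qed.

Lemma psd_scalar n (c : R) : 0 <= c -> psdmx ((c%:C)%:M : 'M[C]_n).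
Proof.
move=> c0 v; rewrite mul_mx_scalar -scalemxAl mxE mulr_ge0 ?ler0c //.
rewrite mxE sumr_ge0 // => i _; rewrite !mxE mulrC -abs2E ler0c; exact: abs2_ge0.
Qed.

Lemma mixed_state n : (0 < n)%N -> is_state (((n%:R^-1 : R)%:C)%:M : 'M[C]_n).
Proof.
move=> n0; split; first by apply: psd_scalar; rewrite invr_ge0.
rewrite mxtrace_scalar -(rmorphMn (real_complex R)) -mulr_natr mulVf ?rmorph1 //.
by rewrite pnatr_eq0 -lt0n.
Qed.

Lemma mixed_separable a b : (0 < a)%N -> (0 < b)%N ->
  @separable R a b (((a * b)%:R^-1 : R)%:C)%:M.
Proof.
move=> a0 b0; exists 1%N, (fun=> 1), (fun=> ((a%:R^-1 : R)%:C)%:M),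
  (fun=> ((b%:R^-1 : R)%:C)%:M); split => //.
- by rewrite big_ord1.
- by move=> _; split; exact: mixed_state.
rewrite big_ord1 rmorph1 scale1r tensmx_tens2; apply/matrixP => i j.
rewrite !mxE (eq_fg (unfg_bij a b)) natrM invfM rmorphM /=.
by case: (unf i == unf j); case: (ung i == ung j); rewrite /= ?mulr1n ?mulr0n ?mulr0 ?mul0r.
Qed.

(** Acts on the [A] index and the [B] index separately, so that a product of two bipartite operators
    is regrouped without mixing the sides of the cut. *)
Definition pairf A B a b (fA : 'I_A -> 'I_a) (fB : 'I_B -> 'I_b) (i : 'I_(A * B)) :=
  mxtens_index (fA (unf i), fB (ung i)).

(** Regrouping collects [al], [al'] into an [A] factor and [be], [be'] into a [B] factor; the
    mixture runs over pairs of indices. *)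
Lemma separable_tens2 a b a' b' A B
  (fA : 'I_A -> 'I_a) (gA : 'I_A -> 'I_a') (fB : 'I_B -> 'I_b) (gB : 'I_B -> 'I_b')
  (s : 'M[C]_(a * b)) (t : 'M[C]_(a' * b')) :
  bij2 fA gA -> bij2 fB gB -> separable s -> separable t ->
  @separable R A B
   (tens2 (pairf fA fB) (pairf gA gB) s t).
Proof.
move=> bA bB [k [p [al [be [p0 p1 st ->]]]]] [k' [p' [al' [be' [p0' p1' st' ->]]]]].
exists (k * k')%N, (fun i => p (unf i) * p' (ung i)),
  (fun i => tens2 fA gA (al (unf i)) (al' (ung i))),
  (fun i => tens2 fB gB (be (unf i)) (be' (ung i))); split.
- by move=> j; rewrite mulr_ge0.
- by rewrite (sum_tens2M (unfg_bij k k')) p1 p1' mulr1.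
- move=> j; have [? ?] := st (unf j); have [? ?] := st' (ung j).
  by split; apply: state_tens2.
apply/matrixP => i j; rewrite !mxE !summxE.
rewrite -(sum_tens2M (unfg_bij k k')); apply: eq_bigr => l _.
by rewrite !mxE !mxtens_indexK /= rmorphM /=; ring.
Qed.

Lemma pairf_bij A B a b a' b'
  (fA : 'I_A -> 'I_a) (gA : 'I_A -> 'I_a') (fB : 'I_B -> 'I_b) (gB : 'I_B -> 'I_b') :
  bij2 fA gA -> bij2 fB gB ->
  bij2 (pairf fA fB) (pairf gA gB).
Proof.
move=> [hA hA1 hA2] [hB hB1 hB2].
exists (fun u => mxtens_index (hA (unf u.1, unf u.2), hB (ung u.1, ung u.2))).
  by move=> i; rewrite /pairf !unfK !ungK (hA1 _) (hB1 _) unfgK.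
move=> [x y]; have := hA2 (unf x, unf y); have := hB2 (ung x, ung y).
by rewrite /pairf !unfK !ungK => -[-> ->] [-> ->]; rewrite !unfgK.
Qed.

End Tens2.

(** * Entropy inequalities and the lower bound on the smoothed quantity *)

Section Entropy.
Variable R : realType.
Local Notation C := R[i].

Lemma ln2_gt0 : 0 < ln 2 :> R.
Proof. by rewrite ln_gt0 // ltr1n. Qed.

Lemma log2_2 : log2 2 = 1 :> R.
Proof. by rewrite /log2 divff // gt_eqF // ln2_gt0. Qed.

Lemma log2M (x y : R) : 0 < x -> 0 < y -> log2 (x * y) = log2 x + log2 y.
Proof. by move=> x0 y0; rewrite /log2 lnM ?posrE // mulrDl. Qed.

Lemma log2V (x : R) : 0 < x -> log2 x^-1 = - log2 x.
Proof. by move=> x0; rewrite /log2 lnV ?posrE // mulNr. Qed.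

Lemma ler_log2 (x y : R) : 0 < x -> x <= y -> log2 x <= log2 y.
Proof.
move=> x0 xy; have y0 := lt_le_trans x0 xy.
by rewrite /log2 ler_pM2r ?invr_gt0 ?ln2_gt0 // ler_ln ?posrE.
Qed.

Lemma log2_le0 (x : R) : x <= 1 -> log2 x <= 0.
Proof. by move=> x1; rewrite pmulr_lle0 ?invr_gt0 ?ln2_gt0 // ln_le0. Qed.

Lemma log2_ge0 (x : R) : 1 <= x -> 0 <= log2 x.
Proof. by move=> x1; apply: divr_ge0; [exact: ln_ge0|exact/ltW/ln2_gt0]. Qed.

Lemma ln_leB1 (x : R) : 0 < x -> ln x <= x - 1.
Proof.
move=> x0; have h := @le_ln1Dx R (x - 1).
have e : 1 + (x - 1) = x by ring.
by rewrite e in h; apply: h; lra.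
Qed.

Lemma log2_leB1 (x : R) : 0 < x -> log2 x <= (x - 1) / ln 2.
Proof. by move=> x0; rewrite ler_pM2r ?invr_gt0 ?ln2_gt0 // ln_leB1. Qed.

(* [cross P U r (log2 \o s)] is [Tr w log w'] for [w = opf P r], [w' = opf U s] *)
Definition cross n (P U : 'M[C]_n) (r f : 'I_n -> R) : R :=
  \sum_i \sum_j r i * ov P U i j * f j.

(** This is [log2 x <= (x - 1) / ln 2] at [x = s / r], multiplied by [r * o]. The last hypothesis
    settles [s = 0], where [log2] has its default value 0. *)
Lemma klein_term (r s o : R) : 0 <= r -> 0 <= s -> 0 <= o -> (s = 0 -> r * o = 0) ->
  (r * o - o * s) / ln 2 <= r * log2 r * o - r * o * log2 s.
Proof.
move=> r0 s0 o0 h; have l2 := ln2_gt0.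
have [re|rn] := eqVneq r 0.
  by rewrite re !mul0r !sub0r oppr0 mulNr oppr_le0 !mulr_ge0 // invr_ge0 ltW.
have rp : 0 < r by rewrite lt_neqAle eq_sym rn.
have [se|sn] := eqVneq s 0.
  by rewrite (mulrAC r) (h se) se !mul0r mulr0 subrr mul0r.
have sp : 0 < s by rewrite lt_neqAle eq_sym sn.
have := log2_leB1 (divr_gt0 sp rp).
rewrite log2M ?invr_gt0 // log2V // => k.
have -> : r * log2 r * o - r * o * log2 s = r * o * (log2 r - log2 s) by ring.
have -> : (r * o - o * s) / ln 2 = r * o * ((1 - s / r) / ln 2).
  by rewrite mulrA; congr (_ / _); field.
rewrite ler_wpM2l ?mulr_ge0 //.
have e : (1 - s / r) / ln 2 = - ((s / r - 1) / ln 2) by field; rewrite !gt_eqF.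
lra.
Qed.

(** As [ov] is doubly stochastic, both sides are double sums that compare term by term. The last
    hypothesis expresses inclusion of supports; the difference of traces stays in the bound because
    smoothed operators are subnormalised. *)
Lemma klein n (P U : 'M[C]_n) (r s : 'I_n -> R) : P \is unitarymx -> U \is unitarymx ->
  (forall i, 0 <= r i) -> (forall j, 0 <= s j) ->
  (forall i j, s j = 0 -> r i * ov P U i j = 0) ->
  (\sum_i r i - \sum_j s j) / ln 2 <=
  \sum_i r i * log2 (r i) - cross P U r (fun j => log2 (s j)).
Proof.
move=> Pu Uu r0 s0 h.
have -> : (\sum_i r i - \sum_j s j) / ln 2 =
    \sum_i \sum_j (r i * ov P U i j - ov P U i j * s j) / ln 2.
  under [RHS]eq_bigr do rewrite -mulr_suml sumrB.
  rewrite -mulr_suml sumrB; congr ((_ - _) / _).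
    by apply: eq_bigr => i _; rewrite -mulr_sumr ov_row // mulr1.
  by rewrite exchange_big; apply: eq_bigr => j _; rewrite -mulr_suml ov_col // mul1r.
have -> : \sum_i r i * log2 (r i) = \sum_i \sum_j r i * log2 (r i) * ov P U i j.
  by apply: eq_bigr => i _; rewrite -mulr_sumr ov_row // mulr1.
rewrite -sumrB; apply: ler_sum => i _; rewrite -sumrB; apply: ler_sum => j _.
by apply: klein_term => //; [exact: ov_ge0|exact: h].
Qed.

(* Testing [r <= mu s] on the vector [s^-1 e_i], [e_i] the i-th eigenvector of [r]. *)
Lemma domination_diag n (P U : 'M[C]_n) (r s : 'I_n -> R) (mu : R) i : P \is unitarymx -> U \is unitarymx ->
  (forall i, 0 <= r i) -> (forall j, 0 < s j) -> 0 < mu ->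
  mxle (opf P r) (mu%:C *: opf U s) ->
  r i * (\sum_j ov P U i j / s j) <= mu.
Proof.
move=> Pu Uu r0 s0 mu0 h; set t := \sum_j _.
pose W := P *m adjm U.
pose y : 'cV[C]_n := \col_j (Num.conj (W i j) * ((s j)^-1)%:C).
pose u := adjm U *m y.
have := psd_qf u h; rewrite qfB opfZ !qf_opf.
have -> : U *m u = y by rewrite mulmxA unitary_mulV // mul1mx.
have -> : P *m u = W *m y by rewrite mulmxA.
have -> : (W *m y) = \col_k (\sum_j W k j * y j 0).
  by apply/colP => k; rewrite !mxE.
rewrite -rmorphB /= ler0c subr_ge0.
have -> : \sum_j mu * s j * abs2 (y j 0) = mu * t.
  rewrite mulr_sumr; apply: eq_bigr => j _; rewrite mxE abs2M abs2_real.
  have -> : abs2 (Num.conj (W i j)) = ov P U i j.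
    by apply: (@complexI R); rewrite /ov !abs2E conjCK mulrC.
  by field; rewrite gt_eqF.
move=> le1; have t0 : 0 <= t.
  by apply: sumr_ge0 => j _; rewrite divr_ge0 ?ov_ge0 // ltW.
(* Of the form of [opf P r] only the [i]-th term is kept; it equals [r i * t ^+ 2], and one factor
   [t] cancels below. *)
have le2 : r i * t ^+ 2 <= mu * t.
  apply: le_trans le1; rewrite (bigD1 i) //= mxE.
  have -> : \sum_j W i j * y j 0 = t%:C.
    rewrite sum_real_complex; apply: eq_bigr => j _.
    by rewrite [y _ _]mxE mulrA [RHS](rmorphM (real_complex R)) /= /ov abs2E.
  rewrite abs2_real lerDl sumr_ge0 // => k _.
  by rewrite mulr_ge0 ?abs2_ge0.
have [->|tn] := eqVneq t 0; first by rewrite mulr0 ltW.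
have tp : 0 < t by rewrite lt_neqAle eq_sym tn.
by rewrite -(ler_pM2r tp) -mulrA -expr2.
Qed.

(** Along the [i]-th eigenvector of the first operator, concavity of the logarithm bounds the mean
    of [log2 (s j)^-1] by the logarithm of the mean of [(s j)^-1], and [domination_diag] bounds that
    mean by [mu / r i]. *)
Lemma domination n (P U : 'M[C]_n) (r s : 'I_n -> R) (mu : R) : P \is unitarymx -> U \is unitarymx ->
  (forall i, 0 <= r i) -> (forall j, 0 < s j) -> 0 < mu ->
  mxle (opf P r) (mu%:C *: opf U s) ->
  \sum_i r i * log2 (r i) - cross P U r (fun j => log2 (s j)) <=
  (\sum_i r i) * log2 mu.
Proof.
move=> Pu Uu r0 s0 mu0 h; rewrite mulr_suml -sumrB; apply: ler_sum => i _.
have [ri|rn] := eqVneq (r i) 0.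
  by rewrite ri !mul0r sub0r big1 ?oppr0 // => j _; rewrite !mul0r.
have rp : 0 < r i by rewrite lt_neqAle eq_sym rn r0.
have ht := domination_diag i Pu Uu r0 s0 mu0 h.
pose ka := mu / r i; have ka0 : 0 < ka by rewrite divr_gt0.
have -> : \sum_j r i * ov P U i j * log2 (s j) =
    r i * (\sum_j ov P U i j * log2 (s j)).
  by rewrite mulr_sumr; apply: eq_bigr => j _; rewrite mulrA.
rewrite -mulrBr ler_pM2l //.
suff : - (\sum_j ov P U i j * log2 (s j)) <= log2 ka.
  by rewrite /ka log2M ?invr_gt0 // log2V //; lra.
have -> : - (\sum_j ov P U i j * log2 (s j)) = \sum_j ov P U i j * log2 ((s j)^-1).
  by rewrite -sumrN; apply: eq_bigr => j _; rewrite log2V // mulrN.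
(* Jensen's inequality, obtained from the tangent line of [log2] at [ka]. *)
apply: (@le_trans _ _ (\sum_j ov P U i j *
    (log2 ka + ((s j)^-1 / ka - 1) / ln 2))).
  apply: ler_sum => j _; rewrite ler_wpM2l ?ov_ge0 //.
  have sk : 0 < (s j)^-1 / ka by rewrite divr_gt0 ?invr_gt0.
  have e : (s j)^-1 = ka * ((s j)^-1 / ka) by field; rewrite !gt_eqF.
  by rewrite {1}e log2M // lerD2l log2_leB1.
have -> : \sum_j ov P U i j * (log2 ka + ((s j)^-1 / ka - 1) / ln 2) =
    log2 ka + ((\sum_j ov P U i j / s j) / ka - 1) / ln 2.
  under eq_bigr do rewrite mulrDr.
  rewrite big_split /= -mulr_suml ov_row // mul1r; congr (_ + _).
  under eq_bigr do rewrite mulrA mulrBr mulr1 mulrA.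
  by rewrite -mulr_suml sumrB -mulr_suml ov_row.
rewrite gerDl pmulr_lle0 ?invr_gt0 ?ln2_gt0 // subr_le0 ler_pdivrMr // mul1r.
by rewrite /ka ler_pdivlMr // mulrC.
Qed.

(** Hölder's inequality between trace norm and operator norm: the trace is expanded in the
    eigenbasis of [H], and each row of [ov] sums to 1. *)
Lemma trnorm_dual n (H U : 'M[C]_n) f (c B : R) : adjm H = H -> U \is unitarymx ->
  0 <= c -> (forall j, `|f j| <= c) -> trnorm H <= B%:C ->
  `|complex.Re (\tr (H *m opf U f))| <= c * B.
Proof.
move=> hH Uu c0 fc; rewrite (trnorm_herm hH) lecR => hB.
have Pu := spectral_unitarymx H.
rewrite {1}(herm_spectral hH) tr_opf2 /=.
apply: (@le_trans _ _ (\sum_i \sum_j `|eig H i| * ov (spectralmx H) U i j * c)).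
  apply: le_trans (ler_norm_sum _ _ _) _; apply: ler_sum => i _.
  apply: le_trans (ler_norm_sum _ _ _) _; apply: ler_sum => j _.
  by rewrite !normrM (ger0_norm (ov_ge0 _ _ _ _)) ler_wpM2l // mulr_ge0 // ov_ge0.
under eq_bigr do rewrite -mulr_suml -mulr_sumr ov_row // mulr1.
by rewrite -mulr_suml mulrC ler_wpM2l.
Qed.

Lemma tr_relentE n (w s : 'M[C]_n) : adjm w = w ->
  complex.Re (\tr (w *m (mxlog2 w - mxlog2 s))) =
  \sum_i eig w i * log2 (eig w i) -
  cross (spectralmx w) (spectralmx s) (eig w) (fun j => log2 (eig s j)).
Proof.
move=> hw; rewrite mulmxBr linearB /= Re_B; congr (_ - _).
  rewrite {1}(herm_spectral hw) mxlog2E opfM; last exact: spectral_unitarymx.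
  by rewrite tr_opf //; exact: spectral_unitarymx.
by rewrite {1}(herm_spectral hw) mxlog2E tr_opf2.
Qed.

Lemma psd_eig n (w : 'M[C]_n) : psdmx w -> forall i, 0 <= eig w i.
Proof.
move=> hw; apply: (opf_psd (spectral_unitarymx w)).
by rewrite -(herm_spectral (psd_herm hw)).
Qed.

Lemma tr_eig n (w : 'M[C]_n) : adjm w = w -> \tr w = (\sum_i eig w i)%:C.
Proof.
by move=> hw; rewrite {1}(herm_spectral hw) tr_opf //; exact: spectral_unitarymx.
Qed.

Lemma state_eig n (w : 'M[C]_n) : is_state w -> \sum_i eig w i = 1.
Proof. by move=> [hw tw]; have := tr_eig (psd_herm hw); rewrite tw => -[]. Qed.

Lemma sum1_le1 n (r : 'I_n -> R) : (forall i, 0 <= r i) -> \sum_i r i = 1 ->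
  forall i, r i <= 1.
Proof. by move=> r0 <- i; rewrite (bigD1 i) //= lerDl sumr_ge0. Qed.

Lemma qf_diag_ov n (P U : 'M[C]_n) r j :
  qf (opf P r) (adjm U *m delta_mx j 0) = (\sum_i r i * ov P U i j)%:C.
Proof.
rewrite qf_opf; congr (_%:C); apply: eq_bigr => i _; congr (_ * abs2 _).
rewrite mulmxA mxE (bigD1 j) //= big1 ?addr0 => [|k kj].
  by rewrite [delta_mx _ _ _ _]mxE !eqxx mulr1.
by rewrite [delta_mx _ _ _ _]mxE (negbTE kj) mulr0.
Qed.

(** An eigenvector of [s] for the eigenvalue 0 lies in the kernel of [s], hence of [w], so the
    quadratic form of [w] vanishes on it; that form is the sum over [i] of these nonnegative
    terms. *)
Lemma kermx_sub_ov n (w s : 'M[C]_n) : psdmx w -> psdmx s ->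
  (kermx s <= kermx w)%MS -> forall i j, eig s j = 0 ->
  eig w i * ov (spectralmx w) (spectralmx s) i j = 0.
Proof.
move=> hw hs hk i j sj0; set P := spectralmx w; set U := spectralmx s.
have Pu : P \is unitarymx := spectral_unitarymx w.
have Uu : U \is unitarymx := spectral_unitarymx s.
pose e : 'rV[C]_n := delta_mx 0 j *m U.
have es : e *m s = 0.
  rewrite (herm_spectral (psd_herm hs)) -/U /e /opf !mulmxA.
  rewrite -(mulmxA _ U) unitary_mulV // mulmx1.
  rewrite mul_mx_diag; set D := (X in X *m U); suff -> : D = 0 by rewrite mul0mx.
  apply/rowP => k; rewrite !mxE; case: (eqVneq k j) => [->|_]; last first.
    by rewrite andbF mul0r.
  by rewrite sj0 mulr0.
have ew : e *m w = 0.
  by apply/sub_kermxP; apply: submx_trans hk; apply/sub_kermxP.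
have := qf_diag_ov P U (eig w) j; rewrite -(herm_spectral (psd_herm hw)).
have -> : qf w (adjm U *m delta_mx j 0) = 0.
  rewrite /qf adjmM adjmK.
  have -> : adjm (delta_mx j 0 : 'cV[C]_n) = delta_mx 0 j.
    by apply/rowP => k; rewrite !mxE rmorph_nat andbC.
  by rewrite -/e ew mul0mx mxE.
move=> -[] /esym h; apply: (psumr_eq0P _ h) => // k _.
by rewrite mulr_ge0 ?ov_ge0 ?psd_eig.
Qed.

Lemma relent_ge0 n (w s : 'M[C]_n) : is_state w -> is_state s -> (0 <= relent w s)%E.
Proof.
move=> hw hs; rewrite /relent; case: ifP => hk; last exact: le0y.
have [w0 _] := hw; have [s0 _] := hs.
rewrite lee_fin (tr_relentE _ (psd_herm w0)).
have := klein (spectral_unitarymx w) (spectral_unitarymx s) (psd_eig w0) (psd_eig s0)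
  (kermx_sub_ov w0 s0 hk).
by rewrite !state_eig // subrr mul0r.
Qed.

Lemma psd_tr n (M : 'M[C]_n) : psdmx M -> 0 <= complex.Re (\tr M).
Proof. by move=> h; rewrite (tr_eig (psd_herm h)) /= sumr_ge0 // => i _; exact: psd_eig. Qed.

Lemma opf_kermx_sub n (P w : 'M[C]_n) f : P \is unitarymx -> (forall i, 0 < f i) ->
  (kermx (opf P f) <= kermx w)%MS.
Proof.
move=> Pu f0; have h : opf P f *m opf P (fun i => (f i)^-1) = 1%:M.
  rewrite opfM // -(opf1 Pu); apply: eq_opf => i.
  by rewrite divff // gt_eqF.
by rewrite -[kermx _]mulmx1 -h mulmxA mulmx_ker mul0mx sub0mx.
Qed.

Lemma eig_ge n (s : 'M[C]_n) (c : R) : adjm s = s -> psdmx (s - (c%:C)%:M) ->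
  forall i, c <= eig s i.
Proof.
move=> hs; have Uu := spectral_unitarymx s.
rewrite {1}(herm_spectral hs) -(opf_cst c Uu) opfB => h i.
by rewrite -subr_ge0; exact: (opf_psd Uu h).
Qed.

Lemma log2_bound (x K : R) : 0 < K -> K^-1 <= x -> x <= 1 -> `|log2 x| <= log2 K.
Proof.
move=> K0 Kx x1; have x0 : 0 < x by apply: lt_le_trans Kx; rewrite invr_gt0.
rewrite ler0_norm ?log2_le0 // -log2V // ler_log2 ?invr_gt0 //.
by rewrite -[K]invrK lef_pV2 ?posrE ?invr_gt0.
Qed.

Lemma entropy_mix n (r z : 'I_n -> R) : (forall i, 0 <= r i) -> \sum_i r i = 1 ->
  (forall i, r i / 2 <= z i) ->
  \sum_i r i * log2 (r i) <= \sum_i r i * log2 (z i) + 1.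
Proof.
move=> r0 r1 hz; rewrite -r1 -big_split /=; apply: ler_sum => i _.
have [->|rn] := eqVneq (r i) 0; first by rewrite !mul0r addr0.
have rp : 0 < r i by rewrite lt_neqAle eq_sym rn r0.
have -> : r i * log2 (z i) + r i = r i * (log2 (z i) + 1) by ring.
rewrite ler_pM2l //.
have r2 : 0 < r i / 2 by rewrite divr_gt0.
have := ler_log2 r2 (hz i); rewrite log2M ?invr_gt0 // log2V // log2_2; lra.
Qed.

(** The lower-bound chain on spectra: [r] belongs to w, [q] to the smoothed w', [t] to the mixed
    reference s'. Mixing keeps eigenvalues above [K^-1], so logarithms are bounded by [log2 K] and
    each exchange of w and w' costs [eps * log2 K]. *)
Lemma smoothing_ineq n (P U V : 'M[C]_n) (r t q : 'I_n -> R) (eps mu : R)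
    (K : R := 2 * n%:R) : (0 < n)%N ->
  P \is unitarymx -> U \is unitarymx -> V \is unitarymx ->
  (forall i, 0 <= r i) -> \sum_i r i = 1 ->
  (forall i, 0 <= q i) -> \sum_i q i <= 1 ->
  (forall i, K^-1 <= t i) -> \sum_i t i = 1 -> 1 <= mu ->
  trnorm (opf V q - opf P r) <= eps%:C -> mxle (opf V q) (mu%:C *: opf U t) ->
  \sum_i r i * log2 (r i) - cross P U r (fun j => log2 (t j)) <=
  log2 mu + 1 + (ln 2)^-1 + 2 * eps * log2 K.
Proof.
move=> n0 Pu Uu Vu r0 r1 q0 q1 tK t1 mu1 hn hle.
have NR : 0 < n%:R :> R by rewrite ltr0n.
have hd : adjm (opf V q - opf P r) = opf V q - opf P r by rewrite adjmB !adj_opf.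
have K0 : 0 < K by rewrite mulr_gt0.
have tp i : 0 < t i by apply: lt_le_trans (tK i); rewrite invr_gt0.
(* [z] is the spectrum of Z, the equal mixture of w and the maximally mixed state, diagonal in the
   basis [P]. *)
have [z [zr zK z1]] : exists z : 'I_n -> R, [/\ forall i, r i / 2 <= z i,
    forall i, K^-1 <= z i & \sum_i z i = 1].
  exists (fun i => (r i + n%:R^-1) / 2); split.
  - by move=> i; rewrite mulrDl lerDl divr_ge0 ?invr_ge0 ?ltW.
  - by move=> i; rewrite /K invfM mulrDl mulrC lerDr divr_ge0.
  rewrite -mulr_suml big_split /= r1 sumr_const card_ord -[_^-1 *+ _]mulr_natr.
  by rewrite mulVf ?gt_eqF // -[1 + 1]/(2%:R) divff.
have zp i : 0 < z i by apply: lt_le_trans (zK i); rewrite invr_gt0.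
have zb i : `|log2 (z i)| <= log2 K.
  by apply: log2_bound => //; apply: sum1_le1 z1 _ => k; exact: ltW.
have tb i : `|log2 (t i)| <= log2 K.
  by apply: log2_bound => //; apply: sum1_le1 t1 _ => k; exact: ltW.
have K1 : 0 <= log2 K.
  apply: log2_ge0; rewrite /K; have : 1 <= n%:R :> R by rewrite ler1n.
  lra.
(* [h1] passes from log w to log Z, [h2] from w to w', [h3] is Klein's inequality for w' and Z, [h4]
   uses the domination of w', [h5] returns to w; [h6] and [h7] handle the trace of w', which lies
   between 0 and 1. *)
have h1 := entropy_mix r0 r1 zr.
have h2 := trnorm_dual hd Pu K1 zb hn.
have h5 := trnorm_dual hd Uu K1 tb hn.
have h3 := klein Vu Pu q0 (fun j => ltW (zp j)).
have {}h3 : (\sum_i q i - 1) / ln 2 <=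
    \sum_i q i * log2 (q i) - cross V P q (fun j => log2 (z j)).
  move: h3; rewrite z1; apply => i j zj.
  by have := zp j; rewrite zj ltxx.
have h4 := domination Vu Uu q0 tp (lt_le_trans ltr01 mu1) hle.
have h6 : (\sum_i q i) * log2 mu <= log2 mu.
  by rewrite -[leRHS]mul1r ler_wpM2r // log2_ge0.
have il2 : 0 <= (ln 2)^-1 :> R by rewrite invr_ge0 ltW // ln2_gt0.
have h7 : - (ln 2)^-1 <= (\sum_i q i - 1) / ln 2.
  rewrite -[- _]mulN1r; apply: ler_wpM2r => //.
  by rewrite lerBrDl subrr; exact: sumr_ge0.
have trd (Q : 'M[C]_n) f : complex.Re (\tr ((opf V q - opf P r) *m opf Q f)) =
    cross V Q q f - cross P Q r f.
  by rewrite mulmxBl linearB /= Re_B !tr_opf2.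
move: h2 h5; rewrite !trd !ler_norml => /andP[h2 _] /andP[_ h5].
have h8 : cross P P r (fun j => log2 (z j)) = \sum_i r i * log2 (z i).
  have := tr_opf2 P P r (fun j => log2 (z j)).
  by rewrite opfM // tr_opf // => -[].
move: h1 h2 h3 h4 h5 h6 h7; rewrite h8.
have -> : 2 * eps * log2 K = log2 K * eps + log2 K * eps by ring.
move: (_ / ln 2) (log2 K * eps) ((\sum_i q i) * _) => *; lra.
Qed.

(** The equal mixture of [s] with the maximally mixed state is separable, has full rank and
    dominates [wb] with factor [2 * l]. *)
Lemma relent_smoothing a b (w wb s : 'M[C]_(a * b)) (eps l : R) :
  (0 < a)%N -> (0 < b)%N -> is_state w -> separable s -> psdmx wb ->
  trnorm (wb - w) <= eps%:C -> eps <= 2^-1 -> \tr wb <= \tr w -> 0 < l ->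
  mxle wb (l%:C *: s) ->
  exists2 s', separable s' &
    (relent w s' <=
     (log2 l + 2 + (ln 2)^-1 + 2 * eps * log2 (2 * (a * b)%:R))%:E)%E.
Proof.
move=> a0 b0 hw hs hwb hn e2 htr l0 hl.
set N := (a * b)%N; have N0 : (0 < N)%N by rewrite muln_gt0 a0.
have NR : 0 < N%:R :> R by rewrite ltr0n.
pose tau : 'M[C]_N := ((N%:R^-1 : R)%:C)%:M.
have tau0 : psdmx tau by apply: psd_scalar; rewrite invr_ge0 ltW.
have [s' s'E] : exists s' : 'M[C]_(a * b), s' = (2^-1)%:C *: (s + tau) by eexists.
have hs' : separable s'.
  by rewrite s'E; apply: separable_half => //; exact: mixed_separable.
exists s' => //.
have [w0 tw] := hw; have [s0 ts] := separable_state hs.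
have [s'0 ts'] := separable_state hs'.
have hwH := psd_herm w0; have hs'H := psd_herm s'0; have hwbH := psd_herm hwb.
have q1 : \sum_i eig wb i <= 1 by move: htr; rewrite tw (tr_eig hwbH) lecR.
have tK : forall i, (2 * N%:R)^-1 <= eig s' i.
  have h : s' - (((2 * N%:R)^-1 : R)%:C)%:M = (2^-1)%:C *: s.
    rewrite s'E; apply/matrixP => i j; rewrite !mxE invfM rmorphM /=.
    by case: (i == j); rewrite ?mulr1n ?mulr0n; ring.
  apply: (eig_ge hs'H); rewrite h; apply: psd_scale s0.
  by rewrite invr_ge0.
(* Testing [wb - w] against the identity gives trace at least [1 - eps] for [wb]; hence
   [2 * l >= 1], as [smoothing_ineq] requires. *)
have be2 : 2^-1 <= \sum_i eig wb i.
  have Pu := spectral_unitarymx w.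
  have hd : adjm (wb - w) = wb - w by rewrite adjmB hwH hwbH.
  have n1 (j : 'I_N) : `|1 : R| <= 1 by rewrite normr1.
  have := trnorm_dual hd Pu ler01 n1 hn.
  rewrite opf1 // mulmx1 linearB /= tw (tr_eig hwbH) Re_B /= mul1r ler_norml.
  move=> /andP[h _]; move: (\sum_i _) h e2 => x; clear; lra.
have l2 : 2^-1 <= l.
  have := psd_tr hl; rewrite linearB /= mxtraceZ ts mulr1 (tr_eig hwbH) Re_B /=.
  by move: (\sum_i _) be2 => x; clear; lra.
have hle : mxle wb ((2 * l)%:C *: s').
  rewrite /mxle; have -> : (2 * l)%:C *: s' - wb = (l%:C *: s - wb) + l%:C *: tau.
    rewrite s'E scalerA -rmorphM /= mulrAC divff // mul1r scalerDr.
    by rewrite addrAC.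
  exact: (psd_add hl (psd_scale (ltW l0) tau0)).
have tp i : 0 < eig s' i by apply: lt_le_trans (tK i); rewrite invr_gt0 mulr_gt0.
have [Pu [Uu Vu]] := (spectral_unitarymx w,
  (spectral_unitarymx s', spectral_unitarymx wb)).
have l21 : 1 <= 2 * l by move: l2; clear; lra.
have := smoothing_ineq N0 Pu Uu Vu (psd_eig w0) (state_eig hw) (psd_eig hwb) q1 tK
  (state_eig (separable_state hs')) l21.
rewrite -(herm_spectral hwH) -(herm_spectral hs'H) -(herm_spectral hwbH).
move=> /(_ _ hn hle); rewrite log2M // log2_2 -(tr_relentE _ hwH) => h.
rewrite /relent; have -> : (kermx s' <= kermx w)%MS.
  by have := opf_kermx_sub w Uu tp; rewrite -(herm_spectral hs'H).
rewrite lee_fin; apply: le_trans h _.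
by rewrite !lerD2r; move: (log2 l) => x; clear; lra.
Qed.

End Entropy.

(** * Typical projectors and gentle measurement *)

Section Typical.
Variable R : realType.
Local Notation C := R[i].

Definition fro2 m n (A : 'M[C]_(m, n)) : R := \sum_i \sum_j abs2 (A i j).

Lemma fro2E m n (A : 'M[C]_(m, n)) : (fro2 A)%:C = \tr (A *m adjm A).
Proof.
rewrite /fro2 sum_real_complex; apply: eq_bigr => i _.
rewrite sum_real_complex mxE; apply: eq_bigr => j _.
by rewrite abs2E !mxE.
Qed.

Lemma fro2_mul_tr m n p (F : 'M[C]_(m, n)) (K : 'M[C]_(n, p)) :
  (fro2 (F *m K))%:C = \tr ((adjm F *m F) *m (K *m adjm K)).
Proof. by rewrite fro2E adjmM mulmxA mxtrace_mulC !mulmxA. Qed.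

Lemma adj_unitary n (U : 'M[C]_n) : U \is unitarymx -> adjm U \is unitarymx.
Proof. by move=> Uu; apply: mulV_unitary; rewrite adjmK unitary_Vmul. Qed.

Lemma fro2_unitary m n (U : 'M[C]_m) (A : 'M[C]_(m, n)) : U \is unitarymx ->
  fro2 (U *m A) = fro2 A.
Proof.
move=> Uu; apply: (@complexI R); rewrite !fro2E adjmM mxtrace_mulC -mulmxA.
by rewrite (mulmxA _ U) unitary_Vmul // mul1mx mxtrace_mulC.
Qed.

Lemma fro2_opf_le m n (U : 'M[C]_m) f (A : 'M[C]_(m, n)) : U \is unitarymx ->
  (forall i, `|f i| <= 1) -> fro2 (opf U f *m A) <= fro2 A.
Proof.
move=> Uu f1; rewrite /opf -!mulmxA fro2_unitary ?adj_unitary //.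
rewrite -(fro2_unitary A Uu); apply: ler_sum => i _; apply: ler_sum => j _.
rewrite mul_diag_mx !mxE abs2M abs2_real -[leRHS]mul1r ler_wpM2r ?abs2_ge0 //.
by rewrite -real_normK ?num_real // expr_le1.
Qed.

Lemma fro2D m n (A B : 'M[C]_(m, n)) : fro2 (A + B) <= 2 * fro2 A + 2 * fro2 B.
Proof.
rewrite /fro2 !mulr_sumr -big_split; apply: ler_sum => i _.
rewrite /= !mulr_sumr -big_split; apply: ler_sum => j _.
rewrite /= mxE /abs2; case: (A i j) (B i j) => [a b] [c d] /=.
have := sqr_ge0 (a - c); have := sqr_ge0 (b - d); nra.
Qed.

Lemma fro2N m n (A : 'M[C]_(m, n)) : fro2 (- A) = fro2 A.
Proof.
apply: eq_bigr => i _; apply: eq_bigr => j _.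
by rewrite mxE /abs2; case: (A i j) => a b /=; rewrite !sqrrN.
Qed.

(** Separates the losses caused by two successive projections, so that each is estimated on the
    undisturbed [K]. *)
Lemma mulmx_sub1 m n (A B : 'M[C]_m) (K : 'M[C]_(m, n)) :
  (A *m B - 1%:M) *m K = - ((1%:M - A) *m K + A *m ((1%:M - B) *m K)).
Proof.
rewrite (mulmxA A) -mulmxDl -mulNmx; congr (_ *m _).
by rewrite mulmxBr mulmx1 addrA subrK opprB.
Qed.

Lemma amgm (c x y : R) : 0 < c -> 2 * (x * y) <= c * x ^+ 2 + c^-1 * y ^+ 2.
Proof.
move=> c0; rewrite -subr_ge0.
have -> : c * x ^+ 2 + c^-1 * y ^+ 2 - 2 * (x * y) = c^-1 * (c * x - y) ^+ 2.
  by field; rewrite gt_eqF.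
by rewrite mulr_ge0 ?sqr_ge0 // invr_ge0 ltW.
Qed.

(** Cauchy-Schwarz in weighted arithmetic-geometric form; the free weight [c] replaces square roots
    and is fixed in [gentle_ball]. *)
Lemma fro2_cs m n (A B : 'M[C]_(m, n)) (c : R) : 0 < c ->
  2 * complex.Re (\tr (A *m adjm B)) <= c * fro2 A + c^-1 * fro2 B.
Proof.
move=> c0; rewrite /mxtrace Re_sum /fro2 !mulr_sumr -big_split; apply: ler_sum => i _.
rewrite mxE Re_sum !mulr_sumr -big_split; apply: ler_sum => j _.
rewrite !mxE /abs2; case: (A i j) (B i j) => [x y] [z w] /=.
have := amgm x z c0; have := amgm y w c0; lra.
Qed.

(** Testing against the sign of [H], taken in its eigenbasis, attains the trace norm. *)
Lemma trnorm_le n (H : 'M[C]_n) (B : R) : adjm H = H ->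
  (forall V f, V \is unitarymx -> (forall i, `|f i| <= 1) ->
    complex.Re (\tr (H *m opf V f)) <= B) ->
  trnorm H <= B%:C.
Proof.
move=> hH h; rewrite (trnorm_herm hH) lecR.
have Vu := spectral_unitarymx H.
have sg1 i : `|Num.sg (eig H i)| <= 1 by rewrite normr_sg; case: (_ != _).
have := h _ _ Vu sg1.
have -> : H *m opf (spectralmx H) (fun i => Num.sg (eig H i)) =
    opf (spectralmx H) (fun i => `|eig H i|).
  rewrite {1}(herm_spectral hH) opfM //; apply: eq_opf => i.
  by rewrite mulrC -normrEsg.
by rewrite tr_opf.
Qed.

(* [T w T^* - w = (T-1)K (TK)^* + K ((T-1)K)^*] for [w = K K^*] *)
Lemma gentle n (K T : 'M[C]_n) (E c : R) : 0 < c -> fro2 K <= 1 ->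
  fro2 (T *m K) <= 1 -> fro2 ((T - 1%:M) *m K) <= E ->
  trnorm (T *m (K *m adjm K) *m adjm T - K *m adjm K) <= (c * E + c^-1)%:C.
Proof.
move=> c0 K1 TK1 hE; set D := (T - 1%:M) *m K in hE.
have eq : T *m (K *m adjm K) *m adjm T - K *m adjm K =
    D *m adjm (T *m K) + K *m adjm D.
  rewrite /D !adjmM adjmB adjm1 !mulmxBl !mulmxBr !mul1mx mulmx1 !mulmxA.
  by rewrite addrA subrK.
apply: trnorm_le => [|V f Vu f1].
  by rewrite adjmB !adjmM !adjmK !mulmxA.
have ci0 : 0 < c^-1 by rewrite invr_gt0.
rewrite eq mulmxDl linearD /= Re_D.
have e1 (A B : 'M[C]_n) : A *m adjm B *m opf V f = A *m adjm (opf V f *m B).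
  by rewrite adjmM adj_opf mulmxA.
rewrite !e1.
have h1 := fro2_cs D (opf V f *m (T *m K)) c0.
have h2 := fro2_cs K (opf V f *m D) ci0; rewrite invrK in h2.
have h3 := fro2_opf_le (T *m K) Vu f1.
have h4 := fro2_opf_le D Vu f1.
have b1 : c * fro2 D <= c * E by rewrite ler_pM2l.
have b2 : c * fro2 (opf V f *m D) <= c * E.
  by rewrite ler_pM2l // (le_trans h4).
have b3 : c^-1 * fro2 (opf V f *m (T *m K)) <= c^-1.
  by rewrite -[leRHS]mulr1 ler_pM2l // (le_trans h3).
have b4 : c^-1 * fro2 K <= c^-1 by rewrite -[leRHS]mulr1 ler_pM2l.
have fin (x y p1 p2 p3 p4 q1 q2 : R) : 2 * x <= p1 + p2 -> 2 * y <= p3 + p4 ->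
  p1 <= q1 -> p4 <= q1 -> p2 <= q2 -> p3 <= q2 -> x + y <= q1 + q2 by clear; lra.
exact: (fin _ _ _ _ _ _ _ _ h1 h2 b1 b2 b3 b4).
Qed.

Lemma mulmx_conj m n p (T : 'M[C]_(m, n)) (K : 'M[C]_(n, p)) :
  T *m (K *m adjm K) *m adjm T = (T *m K) *m adjm (T *m K).
Proof. by rewrite adjmM !mulmxA. Qed.

Lemma gentle_ball n (K T : 'M[C]_n) (E eps : R) : 0 < eps -> fro2 K = 1 ->
  fro2 (T *m K) <= fro2 K -> fro2 ((T - 1%:M) *m K) <= E -> 4 * E <= eps ^+ 2 ->
  Bball eps (K *m adjm K) (T *m (K *m adjm K) *m adjm T).
Proof.
move=> e0 K1 TK1 hE Ee.
have pK : psdmx (K *m adjm K).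
  have := psd_conj K (@psd_scalar R n 1 ler01).
  by rewrite rmorph1 mulmx1.
split; first exact: psd_conj.
split; last by rewrite mulmx_conj -!fro2E lecR.
(* With this weight and [E <= eps ^+ 2 / 4], both terms in the bound of [gentle] are at most
   [eps / 2]. *)
have c0 : 0 < 2 / eps by rewrite divr_gt0.
have K1' : fro2 K <= 1 by rewrite K1.
apply: le_trans (gentle c0 K1' (le_trans TK1 K1') hE) _.
rewrite lecR invf_div.
have : 2 / eps * E <= 2 / eps * (eps ^+ 2 / 4).
  by rewrite ler_pM2l // ler_pdivlMr // mulrC.
have -> : 2 / eps * (eps ^+ 2 / 4) = eps / 2 by field; rewrite gt_eqF.
by move: (_ * E) => x; clear; lra.
Qed.

(** Conjugating [Q w Q <= ka] by the projector [Pi] gives [Pi Q w Q Pi <= ka Pi], which is at most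
    [la S] by hypothesis. *)
Lemma mxle_sandwich n (Pi Q w S : 'M[C]_n) (la ka : R) : adjm Pi = Pi ->
  Pi *m Pi = Pi -> adjm Q = Q -> psdmx (la%:C *: S - ka%:C *: Pi) ->
  psdmx ((ka%:C)%:M - Q *m w *m Q) ->
  mxle (Pi *m Q *m w *m adjm (Pi *m Q)) (la%:C *: S).
Proof.
move=> PiA PiPi QA h1 h2; rewrite /mxle adjmM PiA QA.
have -> : la%:C *: S - Pi *m Q *m w *m (Q *m Pi) =
    (la%:C *: S - ka%:C *: Pi) + Pi *m ((ka%:C)%:M - Q *m w *m Q) *m adjm Pi.
  rewrite PiA mulmxBr mulmxBl mul_mx_scalar -scalemxAl PiPi addrA subrK.
  by rewrite !mulmxA.
exact: (psd_add h1 (psd_conj Pi h2)).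
Qed.

Lemma log2_powR (x : R) : log2 (2 `^ x) = x.
Proof. by rewrite /log2 ln_powR mulfK // gt_eqF // ln2_gt0. Qed.

Lemma log2_le_powR (x y : R) : 0 < x -> log2 x <= y -> x <= 2 `^ y.
Proof.
move=> x0 h; rewrite leNgt; apply/negP => lt; move: h; rewrite leNgt => /negP; apply.
rewrite -[ltLHS](log2_powR y) ltr_pM2r ?invr_gt0 ?ln2_gt0 //.
by rewrite ltr_ln ?posrE // powR_gt0.
Qed.

Lemma powR_le_log2 (x y : R) : 0 < x -> y <= log2 x -> 2 `^ y <= x.
Proof.
move=> x0 h; rewrite leNgt; apply/negP => lt; move: h; rewrite leNgt => /negP; apply.
rewrite -[ltRHS](log2_powR y) ltr_pM2r ?invr_gt0 ?ln2_gt0 //.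
by rewrite ltr_ln ?posrE // powR_gt0.
Qed.

(** The alternative of zero weight serves the zero eigenvalues, where [log2] only has a default
    value and no deviation can be claimed. *)
Lemma chebyshev (T : finType) (p F : T -> R) (Q : pred T) (m v t : R) : 0 < t ->
  (forall i, 0 <= p i) -> (forall i, ~~ Q i -> p i = 0 \/ t ^+ 2 <= (F i - m) ^+ 2) ->
  \sum_i p i * (F i - m) ^+ 2 <= v ->
  \sum_i p i * (1 - (Q i)%:R) <= v / t ^+ 2.
Proof.
move=> t0 p0 hQ hv; rewrite ler_pdivlMr ?exprn_gt0 // mulr_suml.
apply: le_trans hv; apply: ler_sum => i _; have := hQ i.
case: (Q i) => /= [_|/(_ isT) [->|h]].
- by rewrite subrr mulr0 mul0r mulr_ge0 ?sqr_ge0.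
- by rewrite !mul0r.
- by rewrite subr0 mulr1 ler_wpM2l.
Qed.

(** [p] is the law of the outcome when the state is measured in the basis [U]. The exponent
    [a - b + 2 * t] is the gap between the thresholds [a + t] and [b - t]. *)
Lemma typical_smoothing n (P U : 'M[C]_n) (r s : 'I_n -> R) (a b v t eps : R)
    (p := fun j => \sum_i r i * ov P U i j) :
  P \is unitarymx -> U \is unitarymx ->
  (forall i, 0 <= r i) -> \sum_i r i = 1 -> (forall j, 0 <= s j) ->
  (forall j, s j = 0 -> p j = 0) ->
  \sum_i r i * (log2 (r i) - a) ^+ 2 <= v ->
  \sum_j p j * (log2 (s j) - b) ^+ 2 <= v ->
  0 < t -> 0 < eps -> 16 * v <= eps ^+ 2 * t ^+ 2 ->
  exists2 wb, Bball eps (opf P r) wb &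
    mxle wb ((2 `^ (a - b + 2 * t))%:C *: opf U s).
Proof.
move=> Pu Uu r0 r1 s0 sp hr hs t0 e0 hv.
(* Only the upper tail of [r] and the lower tail of [s] are cut off; [0 < s j] is explicit because
   [log2 0 = 0] could pass the second threshold. *)
pose qi i := log2 (r i) <= a + t.
pose pi j := (0 < s j) && (b - t <= log2 (s j)).
have p0 j : 0 <= p j by apply: sumr_ge0 => i _; rewrite mulr_ge0 ?ov_ge0.
have c1 : \sum_i r i * (1 - (qi i)%:R) <= v / t ^+ 2.
  apply: chebyshev hr => // i; rewrite /qi -ltNge => h; right.
  by rewrite ler_sqr ?nnegrE; lra.
have c2 : \sum_j p j * (1 - (pi j)%:R) <= v / t ^+ 2.
  apply: chebyshev hs => // j; rewrite /pi negb_and -leNgt => /orP[h|].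
    by left; apply: sp; apply/eqP; rewrite eq_le h s0.
  rewrite -ltNge => h; right.
  by rewrite -(sqrrN (log2 _ - _)) ler_sqr ?nnegrE; lra.
pose K := opf P (fun i => Num.sqrt (r i)).
pose Pi := opf U (fun j => (pi j)%:R); pose Q := opf P (fun i => (qi i)%:R).
pose T := Pi *m Q.
have b1 (x : bool) : `|x%:R : R| <= 1 by case: x; rewrite ?normr1 ?normr0.
have KK : K *m adjm K = opf P r.
  by rewrite adj_opf opfM //; apply: eq_opf => i; rewrite -expr2 sqr_sqrtr.
have K1 : fro2 K = 1 by apply: (@complexI R); rewrite fro2E KK tr_opf // r1.
have TK1 : fro2 (T *m K) <= fro2 K.
  rewrite /T -mulmxA; apply: le_trans (fro2_opf_le _ Uu (fun j => b1 (pi j))) _.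
  exact: fro2_opf_le.
have sq1 (x : bool) : (1 - x%:R) * (1 - x%:R) = 1 - x%:R :> R.
  by case: x; rewrite ?subrr ?mulr0 // subr0 mulr1.
have f1 : fro2 ((1%:M - Pi) *m K) <= v / t ^+ 2.
  apply: le_trans c2; rewrite -(opf1 Uu) opfB le_eqVlt; apply/orP; left; apply/eqP.
  apply: (@complexI R).
  rewrite fro2_mul_tr KK [adjm _]adj_opf opfM // mxtrace_mulC tr_opf2.
  congr (_%:C); rewrite exchange_big; apply: eq_bigr => j _ /=.
  by rewrite sq1 mulr_suml.
have f2 : fro2 ((1%:M - Q) *m K) <= v / t ^+ 2.
  apply: le_trans c1; rewrite -(opf1 Pu) opfB opfM // le_eqVlt; apply/orP; left.
  apply/eqP; apply: (@complexI R); rewrite fro2E adj_opf opfM // tr_opf //.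
  congr (_%:C); apply: eq_bigr => i _; rewrite mulrACA sq1 -expr2 sqr_sqrtr //.
  by rewrite mulrC.
(* Each projection loses at most [v / t ^+ 2] and [fro2D] doubles both losses; [gentle_ball] brings
   another factor 4, whence the 16 of the hypothesis. *)
have fE : fro2 ((T - 1%:M) *m K) <= 4 * v / t ^+ 2.
  rewrite mulmx_sub1.
  rewrite fro2N; apply: le_trans (fro2D _ _) _.
  have f3 := fro2_opf_le ((1%:M - Q) *m K) Uu (fun j => b1 (pi j)).
  rewrite -mulrA; move: (v / _) f1 f2 f3 => x.
  move: (fro2 _) (fro2 _) (fro2 _) => x1 x2 x3; clear; lra.
exists (T *m opf P r *m adjm T).
  rewrite -KK; apply: (gentle_ball e0 K1 TK1 fE).
  have -> : 4 * (4 * v / t ^+ 2) = 16 * v / t ^+ 2 by ring.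
  by rewrite ler_pdivrMr ?exprn_gt0.
set ka := 2 `^ (a + t); set la := 2 `^ _.
have bb (x : bool) : x%:R * x%:R = x%:R :> R by case: x; rewrite ?mulr0 ?mulr1.
have PiPi : Pi *m Pi = Pi by rewrite opfM //; apply: eq_opf => j; rewrite bb.
have ka0 : 0 < ka by rewrite powR_gt0.
apply: (mxle_sandwich (ka := ka) (adj_opf _ _) PiPi (adj_opf _ _)).
  rewrite !opfZ opfB; apply: psd_opf => j; rewrite subr_ge0 /pi.
  have [sj|_] := ltP 0 (s j); last by rewrite /= mulr0 mulr_ge0 // powR_ge0.
  rewrite andTb; case: (leP (b - t) (log2 (s j))) => h; last by rewrite /= mulr0 mulr_ge0 // powR_ge0.
  rewrite /= mulr1 /ka (_ : a + t = a - b + 2 * t + (b - t)); last by ring.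
  have two0 : (a - b + 2 * t + (b - t) == 0) ==> (2 != 0 :> R).
    by rewrite pnatr_eq0 implybT.
  rewrite (powRD two0); apply: ler_wpM2l; first exact: powR_ge0.
  exact: powR_le_log2.
rewrite !opfM // -(opf_cst _ Pu) opfB; apply: psd_opf => i.
rewrite subr_ge0 /qi; case: (leP (log2 (r i)) (a + t)) => h; last by rewrite /= !mul0r ltW.
rewrite /= mulr1 mul1r; have [->|rn] := eqVneq (r i) 0; first exact: ltW.
by apply: log2_le_powR h; rewrite lt_neqAle eq_sym rn r0.
Qed.

End Typical.

(** * Tensor powers *)

Section TensorPower.
Variable R : realType.
Local Notation C := R[i].

Definition mom n (p F : 'I_n -> R) (a v : R) :=
  \sum_i p i * F i = a /\ \sum_i p i * (F i - a) ^+ 2 <= v.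

(** Means and variances of independent variables add: the cross term factorises through a centred
    mean, which is 0. Additivity of [F] is asked only where [p] is nonzero, since [log2 (x * y)]
    need not split when a factor is 0. *)
Lemma mom_tens2 N n m (f : 'I_N -> 'I_n) (g : 'I_N -> 'I_m)
  (p1 F1 : 'I_n -> R) (p2 F2 : 'I_m -> R) (p F : 'I_N -> R) a1 v1 a2 v2 :
  bij2 f g -> \sum_i p1 i = 1 -> \sum_i p2 i = 1 ->
  mom p1 F1 a1 v1 -> mom p2 F2 a2 v2 -> (forall i, p i = p1 (f i) * p2 (g i)) ->
  (forall i, p i != 0 -> F i = F1 (f i) + F2 (g i)) ->
  mom p F (a1 + a2) (v1 + v2).
Proof.
move=> fg s1 s2 [m1 h1] [m2 h2] pE FE; split.
  have -> : \sum_i p i * F i = \sum_i (p1 (f i) * F1 (f i)) * p2 (g i) +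
      \sum_i p1 (f i) * (p2 (g i) * F2 (g i)).
    rewrite -big_split; apply: eq_bigr => i _ /=.
    have [e|/FE ->] := eqVneq (p i) 0; last by rewrite pE; ring.
    rewrite e mul0r.
    have -> : p1 (f i) * F1 (f i) * p2 (g i) = p i * F1 (f i) by rewrite pE; ring.
    by rewrite mulrA -pE e !mul0r addr0.
  rewrite (sum_tens2M fg (fun i => p1 i * F1 i) p2).
  by rewrite (sum_tens2M fg p1 (fun i => p2 i * F2 i)) s1 s2 m1 m2 mulr1 mul1r.
have z1 : \sum_i p1 i * (F1 i - a1) = 0.
  by under eq_bigr do rewrite mulrBr; rewrite sumrB m1 -mulr_suml s1 mul1r subrr.
have -> : \sum_i p i * (F i - (a1 + a2)) ^+ 2 =
    \sum_i (p1 (f i) * (F1 (f i) - a1) ^+ 2) * p2 (g i) +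
    \sum_i p1 (f i) * (p2 (g i) * (F2 (g i) - a2) ^+ 2) +
    2 * \sum_i (p1 (f i) * (F1 (f i) - a1)) * (p2 (g i) * (F2 (g i) - a2)).
  rewrite mulr_sumr -!big_split; apply: eq_bigr => i _ /=.
  have [e|/FE ->] := eqVneq (p i) 0; last by rewrite pE; ring.
  rewrite e mul0r; rewrite pE in e.
  have -> : p1 (f i) * (F1 (f i) - a1) ^+ 2 * p2 (g i) +
    p1 (f i) * (p2 (g i) * (F2 (g i) - a2) ^+ 2) +
    2 * (p1 (f i) * (F1 (f i) - a1) * (p2 (g i) * (F2 (g i) - a2))) =
    p1 (f i) * p2 (g i) * (F1 (f i) - a1 + (F2 (g i) - a2)) ^+ 2 by ring.
  by rewrite e mul0r.
rewrite (sum_tens2M fg (fun i => p1 i * (F1 i - a1) ^+ 2) p2).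
rewrite (sum_tens2M fg p1 (fun i => p2 i * (F2 i - a2) ^+ 2)).
rewrite (sum_tens2M fg (fun i => p1 i * (F1 i - a1)) (fun i => p2 i * (F2 i - a2))).
by rewrite z1 mul0r mulr0 addr0 s1 s2 mul1r mulr1 lerD.
Qed.

(** * Splitting the index of n + m copies *)

Lemma low_subproof d n m (x : 'I_(d.+1 ^ (n + m))) : (x %% d.+1 ^ n < d.+1 ^ n)%N.
Proof. by rewrite ltn_pmod // expn_gt0. Qed.

Lemma high_subproof d n m (x : 'I_(d.+1 ^ (n + m))) : (x %/ d.+1 ^ n < d.+1 ^ m)%N.
Proof. by rewrite ltn_divLR ?expn_gt0 // mulnC -expnD. Qed.

(** [digit] counts from the least significant digit, so the remainder modulo [d.+1 ^ n] indexes the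
    first [n] copies and the quotient the last [m]. *)
Definition low_digits d n m (x : 'I_(d.+1 ^ (n + m))) := Ordinal (low_subproof x).
Definition high_digits d n m (x : 'I_(d.+1 ^ (n + m))) := Ordinal (high_subproof x).

Lemma low_high_bij d n m : bij2 (@low_digits d n m) (@high_digits d n m).
Proof.
have lt (u : 'I_(d.+1 ^ n) * 'I_(d.+1 ^ m)) :
    (u.2 * d.+1 ^ n + u.1 < d.+1 ^ (n + m))%N.
  rewrite expnD [X in (_ < X)%N]mulnC.
  apply: (@leq_trans (u.2.+1 * d.+1 ^ n)); last by rewrite leq_mul2r ltn_ord orbT.
  by rewrite mulSn addnC ltn_add2r ltn_ord.
exists (fun u => Ordinal (lt u)) => [x|[u v]].
  by apply: val_inj; rewrite /= -divn_eq.
congr (_, _); apply: val_inj => /=.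
  by rewrite modnMDl modn_small.
by rewrite divnMDl ?expn_gt0 // divn_small ?addn0.
Qed.

Lemma digit_low d n m (x : 'I_(d.+1 ^ (n + m))) k : (k < n)%N ->
  digit d (low_digits x) k = digit d x k.
Proof.
move=> kn; rewrite /digit /=; congr inord; move: (nat_of_ord x) => y.
rewrite -(subnK (ltnW kn)) expnD -modn_divl modn_dvdm //.
by rewrite -{1}(expn1 d.+1) dvdn_exp2l // subn_gt0.
Qed.

Lemma digit_high d n m (x : 'I_(d.+1 ^ (n + m))) k :
  digit d (high_digits x) k = digit d x (n + k).
Proof. by rewrite /digit /= -divnMA -expnD. Qed.

Lemma log2M_neq0 (x y : R) : 0 <= x -> 0 <= y -> x != 0 -> y != 0 ->
  log2 (x * y) = log2 x + log2 y.
Proof. by move=> x0 y0 xn yn; rewrite log2M // lt_neqAle eq_sym ?xn ?yn. Qed.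

(* [m1 = Tr w log w] and [m2 = Tr w log w'] for some separable [w'], and [v] bounds
   the variances of [log w] and [log w'] in the state [w]. *)
Definition moments a b (w : 'M[C]_(a * b)) (m1 m2 v : R) := exists P U r s,
  let p := fun j => \sum_i r i * ov P U i j in
  [/\ P \is unitarymx, U \is unitarymx, w = opf P r & separable (opf U s)] /\
  [/\ forall i, 0 <= r i, \sum_i r i = 1, forall j, 0 <= s j,
      forall j, s j = 0 -> p j = 0 &
      mom r (fun i => log2 (r i)) m1 v /\ mom p (fun j => log2 (s j)) m2 v].

(** Overlaps are multiplicative, so the measured law of the product is the product of the laws, and
    [mom_tens2] applies to both logarithms. *)
Lemma moments_tens2 a b a' b' A B
  (fA : 'I_A -> 'I_a) (gA : 'I_A -> 'I_a') (fB : 'I_B -> 'I_b) (gB : 'I_B -> 'I_b')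
  (w : 'M[C]_(a * b)) (w' : 'M[C]_(a' * b')) m1 m2 v m1' m2' v' :
  bij2 fA gA -> bij2 fB gB -> moments w m1 m2 v -> moments w' m1' m2' v' ->
  moments (tens2 (pairf fA fB) (pairf gA gB) w w') (m1 + m1') (m2 + m2') (v + v').
Proof.
move=> bA bB [P [U [r [s [[Pu Uu wE ss] [r0 r1 s0 sp [mr ms]]]]]]].
move=> [P' [U' [r' [s' [[Pu' Uu' wE' ss'] [r0' r1' s0' sp' [mr' ms']]]]]]].
have bij := pairf_bij bA bB; have sep := separable_tens2 bA bB ss ss'.
move: (pairf fA fB) (pairf gA gB) bij sep => f g bij sep.
pose p j := \sum_i r i * ov P U i j.
pose p' j := \sum_i r' i * ov P' U' i j.
have pE j : \sum_i r (f i) * r' (g i) * ov (tens2 f g P P') (tens2 f g U U') i j =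
    p (f j) * p' (g j).
  rewrite -(sum_tens2M bij (fun i => r i * ov P U i _) (fun i => r' i * ov P' U' i _)).
  by apply: eq_bigr => i _; rewrite (ov_tens2 bij) mulrACA.
have Pu2 := tens2_unitary bij Pu Pu'; have Uu2 := tens2_unitary bij Uu Uu'.
exists (tens2 f g P P'), (tens2 f g U U').
exists (fun i => r (f i) * r' (g i)), (fun i => s (f i) * s' (g i)).
split.
  split; [exact: Pu2|exact: Uu2| |].
    by rewrite wE wE' (tens2_opf bij).
  by rewrite -(tens2_opf bij).
split.
- by move=> i; rewrite mulr_ge0.
- by rewrite (sum_tens2M bij) r1 r1' mulr1.
- by move=> j; rewrite mulr_ge0.
- move=> j /eqP; rewrite pE mulf_eq0 => /orP[]/eqP.
    by move=> /sp e; rewrite /p e mul0r.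
  by move=> /sp' e; rewrite /p' e mulr0.
split.
  apply: (mom_tens2 bij r1 r1' mr mr') => // i.
  by rewrite mulf_eq0 negb_or => /andP[? ?]; rewrite log2M_neq0.
have p1 : \sum_j p j = 1 by rewrite sum_ov.
have p1' : \sum_j p' j = 1 by rewrite sum_ov.
apply: (mom_tens2 bij p1 p1' ms ms') => // j.
rewrite pE mulf_eq0 negb_or => /andP[pn pn']; rewrite log2M_neq0 //.
  by apply: contra_neq pn => /sp.
by apply: contra_neq pn' => /sp'.
Qed.

(** The kernel inclusion makes the relative entropy a difference of two means and gives zero weight
    to the zero eigenvalues of [s]. *)
Lemma moments_relent a b (w s : 'M[C]_(a * b)) : is_state w -> separable s ->
  (kermx s <= kermx w)%MS ->
  exists m1 m2 v, moments w m1 m2 v /\ relent w s = (m1 - m2)%:E.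
Proof.
move=> hw hs hk; have hst := separable_state hs.
have [[w0 _] [s0 _]] := (hw, hst).
have wH := psd_herm w0; have sH := psd_herm s0.
have kov := kermx_sub_ov w0 s0 hk.
have wE := herm_spectral wH; have sE := herm_spectral sH.
have rE : relent w s = (\sum_i eig w i * log2 (eig w i) -
    cross (spectralmx w) (spectralmx s) (eig w) (fun j => log2 (eig s j)))%:E.
  by rewrite /relent hk (tr_relentE _ wH).
have Pu := spectral_unitarymx w; have Uu := spectral_unitarymx s.
have r0 := psd_eig w0; have s0' := psd_eig s0; have r1 := state_eig hw.
move: (spectralmx w) (spectralmx s) (eig w) (eig s) kov wE sE rE Pu Uu r0 s0' r1.
move=> P U r t kov wE sE rE Pu Uu r0 t0 r1.
pose p j := \sum_i r i * ov P U i j.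
exists (\sum_i r i * log2 (r i)), (\sum_j p j * log2 (t j)).
set m1 := \sum_i _; set m2 := \sum_j _.
pose v1 := \sum_i r i * (log2 (r i) - m1) ^+ 2.
pose v2 := \sum_j p j * (log2 (t j) - m2) ^+ 2.
exists (Num.max v1 v2); split; last first.
  rewrite rE /cross exchange_big; congr (_ - _)%:E; apply: eq_bigr => j _.
  by rewrite /p mulr_suml.
exists P, U, r, t; split; split; rewrite -?sE; [exact: Pu|exact: Uu|exact: wE|exact: hs| | | | |];
  [exact: r0|exact: r1|exact: t0| |].
- by move=> j tj; apply: big1 => i _; exact: kov.
- by split; split => //; rewrite le_max lexx ?orbT.
Qed.

Lemma Emax_eps_moments a b (w : 'M[C]_(a * b)) m1 m2 v t eps : moments w m1 m2 v ->
  0 < t -> 0 < eps -> 16 * v <= eps ^+ 2 * t ^+ 2 ->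
  (Emax_eps eps w <= (m1 - m2 + 2 * t)%:E)%E.
Proof.
move=> [P [U [r [s [[Pu Uu wE ss] [r0 r1 s0 sp [[_ mr] [_ ms]]]]]]]] t0 e0 hv.
have [wb wbB wbs] := typical_smoothing Pu Uu r0 r1 s0 sp mr ms t0 e0 hv.
apply: (@le_trans _ _ (Dmax_eps eps w (opf U s))).
  by apply: ereal_inf_lbound; exists (opf U s).
apply: (@le_trans _ _ (Dmax wb (opf U s))).
  by apply: ereal_inf_lbound; exists wb; [rewrite wE|].
apply: ereal_inf_lbound; exists (2 `^ (m1 - m2 + 2 * t)); last by rewrite log2_powR.
by split; first exact: powR_gt0.
Qed.

Lemma ER_le_Emax_eps a b (w : 'M[C]_(a * b)) eps : (0 < a)%N -> (0 < b)%N ->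
  is_state w -> eps <= 2^-1 ->
  (ER w - (2 + (ln 2)^-1 + 2 * eps * log2 (2 * (a * b)%:R))%:E <= Emax_eps eps w)%E.
Proof.
move=> a0 b0 hw e2; apply: le_ereal_inf_tmp => _ [s ss <-].
apply: le_ereal_inf_tmp => _ [wb [wb0 [wbn wbt]] <-].
apply: le_ereal_inf_tmp => _ [l [l0 hl] <-].
have [s' ss' hs'] := relent_smoothing a0 b0 hw ss wb0 wbn e2 wbt l0 hl.
rewrite leeBlDr //; apply: (@le_trans _ _ (relent w s')).
  by apply: ereal_inf_lbound; exists s'.
by apply: le_trans hs' _; rewrite -EFinD lee_fin !addrA.
Qed.

Lemma ER_ge0 a b (w : 'M[C]_(a * b)) : is_state w -> (0 <= ER w)%E.
Proof.
move=> hw; apply: le_ereal_inf_tmp => _ [s ss <-]; apply: (relent_ge0 hw).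
exact: separable_state.
Qed.

Lemma kermx_mixed_sub a b (w : 'M[C]_(a * b)) : (0 < a)%N -> (0 < b)%N ->
  (kermx ((((a * b)%:R^-1 : R)%:C)%:M : 'M[C]_(a * b)) <= kermx w)%MS.
Proof.
move=> a0 b0; have u1 : (1%:M : 'M[C]_(a * b)) \is unitarymx.
  by apply: mulV_unitary; rewrite adjm1 mulmx1.
rewrite -(opf_cst _ u1); apply: opf_kermx_sub => // _.
by rewrite invr_gt0 ltr0n muln_gt0 a0.
Qed.

(** The maximally mixed state has full rank, so it is a reference with finite relative entropy for
    every [w]; this yields finiteness of [ER] and the filler blocks of tensor powers. *)
Lemma moments_mixed a b (w : 'M[C]_(a * b)) : (0 < a)%N -> (0 < b)%N -> is_state w ->
  exists m1 m2 v, moments w m1 m2 v /\ (ER w <= (m1 - m2)%:E)%E.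
Proof.
move=> a0 b0 hw; have hm := @mixed_separable R a b a0 b0.
have [m1 [m2 [v [h e]]]] := moments_relent hw hm (kermx_mixed_sub w a0 b0).
exists m1, m2, v; split => //; rewrite -e; apply: ereal_inf_lbound.
by eexists; [exact: hm|].
Qed.

Variables (dA dB : nat) (rho : 'M[C]_(dA.+1 * dB.+1)).
Hypothesis rho_state : is_state rho.

Lemma tpow_add n m :
  tpow rho (n + m) = tens2 (pairf (@low_digits dA n m) (@low_digits dB n m))
    (pairf (@high_digits dA n m) (@high_digits dB n m)) (tpow rho n) (tpow rho m).
Proof.
apply/matrixP => i j; rewrite /tpow /tens2 mxE [RHS]mxE mxE [X in _ * X]mxE.
rewrite [LHS]big_split_ord; congr (_ * _); apply: eq_bigr => k _.
  by rewrite /pairf !mxtens_indexK !digit_low.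
by rewrite /pairf !mxtens_indexK !digit_high.
Qed.

Lemma tpow_state n : is_state (tpow rho n).
Proof.
elim: n => [|n IH].
  have -> : tpow rho 0 = ((1 : R)%:C)%:M.
    apply/matrixP => i j; rewrite !mxE big_ord0.
    have -> : i = j by apply: val_inj; case: i j => [[|i] hi] [[|j] hj].
    by rewrite eqxx.
  split; first by apply: psd_scalar.
  by rewrite mxtrace_scalar.
suff h1 : is_state (tpow rho 1).
  suff: is_state (tpow rho (n + 1)) by rewrite addn1.
  rewrite tpow_add; apply: state_tens2 => //.
  by apply: pairf_bij; exact: low_high_bij.
suff -> : tpow rho 1 = rho :> 'M[C]_(dA.+1 * dB.+1) by [].
have dig d (x : 'I_d.+1) : digit d x 0 = x.
  by apply: val_inj; rewrite /digit /= inordK expn0 divn1 ?ltn_pmod // modn_small.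
apply/matrixP => i j; rewrite !mxE big_ord1 /=.
rewrite (dig dA (mxtens_unindex i).1) (dig dB (mxtens_unindex i).2).
rewrite (dig dA (mxtens_unindex j).1) (dig dB (mxtens_unindex j).2).
by rewrite -!surjective_pairing !mxtens_unindexK.
Qed.

Lemma moments_tpow_add n m m1 m2 v m1' m2' v' :
  moments (tpow rho n) m1 m2 v -> moments (tpow rho m) m1' m2' v' ->
  moments (tpow rho (n + m)) (m1 + m1') (m2 + m2') (v + v').
Proof. by rewrite tpow_add; apply: moments_tens2; exact: low_high_bij. Qed.

Lemma moments_tpow_mul n m m1 m2 v m1' m2' v' q :
  moments (tpow rho n) m1 m2 v -> moments (tpow rho m) m1' m2' v' ->
  moments (tpow rho (n + q * m)) (m1 + q%:R * m1') (m2 + q%:R * m2') (v + q%:R * v').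
Proof.
move=> h h'; elim: q => [|q IH]; first by rewrite mul0n addn0 !mul0r !addr0.
have e (x y : R) : x + q.+1%:R * y = x + q%:R * y + y.
  by rewrite -natr1 mulrDl mul1r addrA.
have -> : (n + q.+1 * m = n + q * m + m)%N by rewrite mulSn addnA addnAC.
by rewrite !e; exact: moments_tpow_add.
Qed.

End TensorPower.

(** * Passing to the limit *)

Section Limits.
Variable R : realType.

Lemma limn_esup_le (u : (\bar R)^nat) (x : \bar R) :
  (\forall n \near \oo, u n <= x)%E -> (limn_esup u <= x)%E.
Proof.
move=> h; apply: ge_ereal_inf; exists (ereal_sup [set u n | n in [set n | (u n <= x)%E]]).
  by exists [set n | (u n <= x)%E].
by apply: ge_ereal_sup => _ [n hn <-].
Qed.

Lemma limn_esup_ge (u : (\bar R)^nat) (x : \bar R) :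
  (\forall n \near \oo, x <= u n)%E -> (x <= limn_esup u)%E.
Proof.
move=> h; apply: le_ereal_inf_tmp => _ [V hV <-].
have [n [Vn xn]] := filter_ex (filterI hV h).
by apply: le_trans xn _; apply: ereal_sup_ubound; exists n.
Qed.

(** [F n] stands for [ER] of [n] copies, [g eps n] for the smoothed quantity, and [1 + n%:R * D] for
    the logarithm of twice the total dimension. The limit is the infimum of [F m / m%:R], which
    bounds every such ratio from below. *)
Lemma regularization_limits (F : nat -> R) (g : R -> nat -> \bar R) (D c : R) :
  0 <= D -> (forall n, 0 <= F n) ->
  (forall eps n, 0 < eps -> eps <= 2^-1 ->
    ((F n - (c + 2 * eps * (1 + n%:R * D)))%:E <= g eps n)%E) ->
  (forall m eps d, (0 < m)%N -> 0 < eps -> 0 < d ->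
    \forall n \near \oo, (g eps n <= (n%:R * (F m / m%:R + d))%:E)%E) ->
  exists L : R, (fun n : nat => (n%:R : R)^-1 * F n) @ \oo --> L /\
    (fun eps : R => limn_esup (fun n : nat => ((n%:R : R)^-1)%:E * g eps n)%E)
      @ 0^'+ --> L%:E.
Proof.
move=> D0 F0 hC hB.
pose E := [set F m / m%:R | m in [set m | (0 < m)%N]].
have infE : has_inf E.
  split; first by exists (F 1%N / 1), 1%N.
  by exists 0 => _ [m m0 <-]; rewrite divr_ge0.
have [_ lbE] := infE.
pose L := inf E; exists L.
have Lle m : (0 < m)%N -> m%:R * L <= F m.
  move=> m0; rewrite -ler_pdivlMl ?ltr0n // mulrC.
  by apply: ge_inf => //; exists m.
have hinf d : 0 < d -> exists2 m, (0 < m)%N & F m / m%:R < L + d.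
  by move=> d0; have [_ [m m0 <-] h] := inf_adherent d0 infE; exists m.
split.
  apply/cvgrPdist_le => e e0.
  have e4 : 0 < e / 4 by rewrite divr_gt0.
  have [m m0 hm] := hinf _ e4.
  (* The lower estimate asks for [2^-1]; the other bound keeps the smoothing error below
     [n%:R * (e / 8)]. Near-optimality of [m], the slack in [hB] and the constant [c] cost [e / 4]
     per copy each. *)
  pose eps := Num.min 2^-1 (e / (16 * (1 + D))).
  have D1 : 0 < 1 + D by rewrite ltr_wpDr.
  have eps0 : 0 < eps by rewrite lt_min invr_gt0 ltr0n divr_gt0 // mulr_gt0.
  have eps2 : eps <= 2^-1 by rewrite ge_min lexx.
  have eps3 : eps * (1 + D) <= e / 16.
    have : eps <= e / (16 * (1 + D)) by rewrite ge_min lexx orbT.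
    by rewrite ler_pdivlMr ?mulr_gt0 // ler_pdivlMr // => h; rewrite -mulrA (mulrC _ 16).
  near=> n.
  have n0 : (0 < n)%N by near: n; exact: nbhs_infty_ge.
  have nR : 1 <= n%:R :> R by rewrite ler1n.
  have nR0 : 0 < n%:R :> R by rewrite ltr0n.
  have hg : (g eps n <= (n%:R * (F m / m%:R + e / 4))%:E)%E.
    by near: n; exact: hB.
  have hc : c <= n%:R * (e / 4).
    rewrite -ler_pdivrMr //; apply: ltW; near: n; exact: nbhs_infty_gtr.
  have := le_trans (hC _ n eps0 eps2) hg; rewrite lee_fin => h.
  have h2 : 2 * eps * (1 + n%:R * D) <= n%:R * (e / 8).
    apply: (@le_trans _ _ (2 * (n%:R * (eps * (1 + D))))).
      have -> : 2 * (n%:R * (eps * (1 + D))) = 2 * eps * (n%:R + n%:R * D) by ring.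
      by rewrite ler_pM2l ?mulr_gt0 // lerD2r.
    have -> : n%:R * (e / 8) = 2 * (n%:R * (e / 16)) by field.
    by rewrite ler_pM2l // ler_pM2l.
  have h3 : n%:R * (F m / m%:R + e / 4) <= n%:R * (L + e / 4 + e / 4).
    by rewrite ler_pM2l // lerD2r ltW.
  have h4 : F n <= n%:R * (L + e).
    have -> : n%:R * (L + e) = n%:R * (L + e / 4 + e / 4) + n%:R * (e / 4) +
      n%:R * (e / 8) + n%:R * (e / 8) by field.
    have : 0 <= n%:R * (e / 8) by rewrite mulr_ge0 // divr_ge0 // ltW.
    move: (n%:R * (L + _ + _)) (n%:R * (e / 4)) (n%:R * (e / 8)) h h2 h3 hc.
    move: (_ * (_ / _ + _)) (2 * _ * _); clear; move=> *; lra.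
  have h5 := Lle n n0.
  have l1 : L <= n%:R^-1 * F n by rewrite ler_pdivlMl.
  have l2 : n%:R^-1 * F n <= L + e by rewrite ler_pdivrMl.
  by rewrite ler_norml; move: l1 l2; clear; move=> *; apply/andP; split; lra.
(* The limit superior is squeezed between [L - 2 * e * D] and [L]: after division by [n], only this
   linear rate survives of the error. *)
have lower : (fun e : R => (L - 2 * e * D)%:E) @ 0^'+ --> L%:E.
  apply: cvg_EFin; first exact: nearW.
  apply/cvgrPdist_le => d d0.
  have D1 : 0 < 2 * (D + 1) by rewrite mulr_gt0 // ltr_wpDl.
  have dD : 0 < d / (2 * (D + 1)) by rewrite divr_gt0.
  near=> e.
  have e0 : 0 < e by near: e; exact: nbhs_right_gt.
  have hd : e <= d / (2 * (D + 1)) by near: e; exact: nbhs_right_le.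
  rewrite /= opprB addrC subrK ger0_norm; last first.
    by rewrite mulr_ge0 // mulr_ge0 // ltW.
  rewrite ler_pdivlMr // in hd; apply: le_trans hd.
  have -> : e * (2 * (D + 1)) = 2 * e * D + 2 * e by ring.
  by rewrite lerDl mulr_ge0 // ltW.
apply: (squeeze_cvge _ lower (cvg_cst _)).
near=> e.
have e0 : 0 < e by near: e; exact: nbhs_right_gt.
have e2 : e <= 2^-1 by near: e; apply: nbhs_right_le; rewrite invr_gt0.
apply/andP; split; apply/lee_addgt0Pr => d d0.
  rewrite -leeBlDr // -EFinB; apply: limn_esup_ge; near=> n.
  have n0 : (0 < n)%N by near: n; exact: nbhs_infty_ge.
  have nR0 : 0 < n%:R :> R by rewrite ltr0n.
  have hc : c + 2 * e <= n%:R * d.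
    rewrite -ler_pdivrMr //; apply: ltW; near: n; exact: nbhs_infty_gtr.
  rewrite -lee_pdivrMl ?invr_gt0 // invrK -EFinM; apply: le_trans (hC _ n e0 e2).
  rewrite lee_fin; have := Lle n n0.
  have -> : n%:R * (L - 2 * e * D - d) = n%:R * L - 2 * e * (n%:R * D) - n%:R * d by ring.
  have -> : 2 * e * (1 + n%:R * D) = 2 * e + 2 * e * (n%:R * D) by ring.
  by move: (_ * d) hc => x; clear; move=> *; lra.
(* Half of the slack pays for near-optimality of [m], half for the upper estimate. *)
have d2 : 0 < d / 2 by rewrite divr_gt0.
have [m m0 hm] := hinf _ d2.
rewrite -EFinD; apply: limn_esup_le; near=> n.
have n0 : (0 < n)%N by near: n; exact: nbhs_infty_ge.
have nR0 : 0 < n%:R :> R by rewrite ltr0n.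
have hg : (g e n <= (n%:R * (F m / m%:R + d / 2))%:E)%E by near: n; exact: hB.
rewrite lee_pdivrMl //; apply: le_trans hg _.
rewrite -EFinM lee_fin ler_pM2l //; move: (F m / _) hm; clear; move=> *; lra.
Unshelve. all: by end_near.
Qed.

End Limits.

(** * Upper estimate for tensor powers and equality of the limits *)

Lemma log2X (R : realType) (x : R) n : 0 < x -> log2 (x ^+ n) = n%:R * log2 x.
Proof. by move=> x0; rewrite /log2 lnXn // -[ln x *+ n]mulr_natl mulrA. Qed.

(* For [n = r + q m] with [r < m], the reference state is [q] copies of a near-optimal
   separable state on [m] copies, completed by [r] maximally mixed states; the block
   of 0 copies only serves to start the induction. *)
Lemma Emax_eps_regularized (R : realType) (dA dB : nat)
    (rho : 'M[R[i]]_(dA.+1 * dB.+1)) (m : nat) (eps d : R) :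
  is_state rho -> (0 < m)%N -> 0 < eps -> 0 < d ->
  \forall n \near \oo, (Emax_eps eps (tpow rho n) <=
    (n%:R * (fine (ER (tpow rho m)) / m%:R + d))%:E)%E.
Proof.
move=> hr m0 eps0 d0; have st := tpow_state hr.
have pA k : (0 < dA.+1 ^ k)%N by rewrite expn_gt0.
have pB k : (0 < dB.+1 ^ k)%N by rewrite expn_gt0.
have mR : 1 <= m%:R :> R by rewrite ler1n.
have mR0 : 0 < m%:R :> R by rewrite ltr0n.
have ERfin : ER (tpow rho m) \is a fin_num.
  rewrite ge0_fin_numE; last exact: ER_ge0.
  have [a [b [v [_ h]]]] := moments_mixed (pA m) (pB m) (st m).
  by apply: le_lt_trans h _; exact: ltry.
have F0 : 0 <= fine (ER (tpow rho m)) by apply: fine_ge0; exact: ER_ge0.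
have [am [bm [vm [hm lm]]]] : exists am bm vm,
    moments (tpow rho m) am bm vm /\ am - bm < fine (ER (tpow rho m)) + d / 4.
  have : (ER (tpow rho m) < (fine (ER (tpow rho m)) + d / 4)%:E)%E.
    by rewrite -[X in (X < _)%E](fineK ERfin) lte_fin ltrDl divr_gt0.
  move=> /ereal_inf_lt[_ [s ss <-] hs].
  (* A relative entropy below a real number is not [+oo], so the supports are nested. *)
  have hk : (kermx s <= kermx (tpow rho m))%MS.
    by move: hs; rewrite /relent; case: ifP.
  have [a [b [v [h e]]]] := moments_relent (st m) ss hk.
  by exists a, b, v; split => //; move: hs; rewrite e lte_fin.
have [a0 [b0 [v0 [h0 _]]]] := moments_mixed (pA 0%N) (pB 0%N) (st 0%N).
have [a1 [b1 [v1 [h1 _]]]] := moments_mixed (pA 1%N) (pB 1%N) (st 1%N).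
pose x0 := a0 - b0; pose x1 := a1 - b1; pose xm := am - bm.
near=> n.
have n0 : (0 < n)%N by near: n; exact: nbhs_infty_ge.
have nR : 1 <= n%:R :> R by rewrite ler1n.
have nR0 : 0 < n%:R :> R by rewrite ltr0n.
pose q := (n %/ m)%N; pose r := (n %% m)%N.
have nE : (0 + r * 1 + q * m = n)%N by rewrite add0n muln1 addnC -divn_eq.
have rm : r%:R <= m%:R :> R by rewrite ler_nat ltnW // ltn_pmod.
have qm : q%:R * m%:R <= n%:R :> R by rewrite -natrM ler_nat leq_trunc_div.
have qn : q%:R <= n%:R :> R by rewrite ler_nat leq_div.
have := moments_tpow_mul r h0 h1 => h01; have := moments_tpow_mul q h01 hm.
rewrite nE => hn.
have hx : `|x0| + m%:R * `|x1| <= n%:R * (d / 4).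
  rewrite -ler_pdivrMr ?divr_gt0 //; apply: ltW; near: n; exact: nbhs_infty_gtr.
have hv : 16 * (`|v0| + m%:R * `|v1| + `|vm|) <= n%:R * (eps ^+ 2 * (d / 8) ^+ 2).
  rewrite -ler_pdivrMr ?mulr_gt0 ?exprn_gt0 ?divr_gt0 //.
  by apply: ltW; near: n; exact: nbhs_infty_gtr.
(* With [t] linear in [n], the right side below is quadratic while the variance bound grows
   linearly. *)
have t0 : 0 < n%:R * (d / 8) by rewrite mulr_gt0 // divr_gt0.
have vle : 16 * (v0 + r%:R * v1 + q%:R * vm) <= eps ^+ 2 * (n%:R * (d / 8)) ^+ 2.
  apply: (@le_trans _ _ (n%:R * (16 * (`|v0| + m%:R * `|v1| + `|vm|)))); last first.
    have -> : eps ^+ 2 * (n%:R * (d / 8)) ^+ 2 =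
      n%:R * (n%:R * (eps ^+ 2 * (d / 8) ^+ 2)) by ring.
    by rewrite ler_pM2l.
  rewrite mulrCA ler_pM2l // !mulrDr; apply: lerD; first apply: lerD.
  - by apply: le_trans (ler_norm v0) _; rewrite ler_peMl.
  - apply: (@le_trans _ _ (m%:R * `|v1|)).
      apply: (@le_trans _ _ (r%:R * `|v1|)); first by rewrite ler_wpM2l // ler_norm.
      by rewrite ler_wpM2r.
    by rewrite ler_peMl // mulr_ge0 // ltW.
  - apply: (@le_trans _ _ (q%:R * `|vm|)); first by rewrite ler_wpM2l // ler_norm.
    by rewrite ler_wpM2r.
apply: le_trans (Emax_eps_moments hn t0 eps0 vle) _; rewrite lee_fin.
have -> : a0 + r%:R * a1 + q%:R * am - (b0 + r%:R * b1 + q%:R * bm) =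
  x0 + r%:R * x1 + q%:R * xm by rewrite /x0 /x1 /xm; ring.
have e0 : x0 <= `|x0| by exact: ler_norm.
have e1 : r%:R * x1 <= m%:R * `|x1|.
  apply: (@le_trans _ _ (r%:R * `|x1|)); first by rewrite ler_wpM2l // ler_norm.
  by rewrite ler_wpM2r.
set Fm := fine _ in F0 lm *.
have e2 : q%:R * xm <= n%:R * (Fm / m%:R + d / 4).
  apply: (@le_trans _ _ (q%:R * (Fm + d / 4))); first by rewrite ler_wpM2l // ltW.
  apply: (@le_trans _ _ (n%:R * ((Fm + d / 4) / m%:R))).
    rewrite mulrA ler_pdivlMr // mulrAC ler_wpM2r //.
    by rewrite addr_ge0 // divr_ge0 // ltW.
  by rewrite ler_pM2l // mulrDl lerD2l ler_pdivrMr // ler_peMr // divr_ge0 // ltW.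
(* Budget for [d]: near-optimality, the constant and filler blocks, and the shift by twice
   [n%:R * (d / 8)] take a quarter each; the last quarter is spare. *)
have -> : n%:R * (Fm / m%:R + d) = n%:R * (Fm / m%:R + d / 4) + n%:R * (d / 4) +
   2 * (n%:R * (d / 8)) + n%:R * (d / 4) by field; rewrite gt_eqF.
have e3 : 0 <= n%:R * (d / 4) by rewrite mulr_ge0 // divr_ge0 // ltW.
move: (n%:R * (_ + d / 4)) (n%:R * (d / 4)) (n%:R * (d / 8)) e2 hx e3.
move: e0 e1; move: (q%:R * xm) (r%:R * x1) (m%:R * `|x1|) `|x0|.
by clear; move=> *; lra.
Unshelve. all: by end_near.
Qed.

Theorem theorem1 (R : realType) (dA dB : nat) (rho : 'M[R[i]]_(dA.+1 * dB.+1)) :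
  is_state rho ->
  exists L : R,
    ((fun n : nat => ((n%:R : R)^-1)%:E * ER (tpow rho n))%E @ \oo --> L%:E)
    /\
    ((fun eps : R =>
        limn_esup (fun n : nat => ((n%:R : R)^-1)%:E * Emax_eps eps (tpow rho n))%E)
       @ 0^'+ --> L%:E).
Proof.
move=> hr; have st := tpow_state hr.
have pA k : (0 < dA.+1 ^ k)%N by rewrite expn_gt0.
have pB k : (0 < dB.+1 ^ k)%N by rewrite expn_gt0.
have ERfin n : ER (tpow rho n) \is a fin_num.
  rewrite ge0_fin_numE; last exact: ER_ge0.
  have [a [b [v [_ h]]]] := moments_mixed (pA n) (pB n) (st n).
  by apply: le_lt_trans h _; exact: ltry.
have F0 n : 0 <= fine (ER (tpow rho n)) by apply: fine_ge0; exact: ER_ge0.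
pose D : R := log2 (dA.+1 * dB.+1)%:R.
have D0 : 0 <= D by apply: log2_ge0; rewrite ler1n muln_gt0.
have hC eps n : 0 < eps -> eps <= 2^-1 ->
    ((fine (ER (tpow rho n)) - (2 + (ln 2)^-1 + 2 * eps * (1 + n%:R * D)))%:E <=
     Emax_eps eps (tpow rho n))%E.
  move=> _ e2; have := ER_le_Emax_eps (pA n) (pB n) (st n) e2.
  rewrite -expnMn natrX log2M ?exprn_gt0 ?ltr0n ?muln_gt0 // log2_2 log2X ?ltr0n ?muln_gt0 //.
  by rewrite EFinB fineK.
have [L [h1 h2]] := regularization_limits D0 F0 hC
  (fun m eps d => @Emax_eps_regularized R dA dB rho m eps d hr).
exists L; split => //.
(* Finiteness of [ER] carries the convergence of the real sequence over to the extended reals. *)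
apply: cvg_EFin; last first.
  apply: cvg_trans h1; apply: near_eq_cvg; apply: nearW => n /=.
  by rewrite -[ER _]fineK // -EFinM.
by apply: nearW => n; rewrite fin_numM.
Qed.
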